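(* For each integer $k\geq 2$ let $M_k=[z^k-w^k]\subset H^2(\mathbb D^2)$. Then for every $k\ge 2$, $$k=\max\{\,j\geq 1:\ \Sigma_j(M_k)=\Sigma_1(M_k)\,\}.$$ Consequently, if $k\neq \ell$ (with $k,\ell\ge2$), then $\{\Sigma_j(M_k)\}_{j\geq 0}\neq\{\Sigma_j(M_\ell)\}_{j\geq 0}$. On the other hand, the nonzero eigenvalues of the core operator $C^{M_k}$, including multiplicities, are independent of $k$ (for $k\ge 2$).
   Context: $H^2(\mathbb D^2)$ is the Hardy space of the bidisk with coordinates $(z,w)$, in which the monomials $z^aw^b$ ($a,b\ge 0$) form an orthonormal basis. For a polynomial $p$, $[p]$ denotes the closure of $p\,\mathbb C[z,w]$ in $H^2(\mathbb D^2)$; it is a submodule, i.e. a closed subspace invariant under multiplication by $z$ and $w$. For a submodule $M$, $R_1,R_2$ are the restrictions to $M$ of multiplication by $z$ and $w$, respectively, $[A,B]=AB-BA$, and $$\Sigma_0(M)=\|[R_2^*,R_2][R_1^*,R_1]\|_{H.S.}^2,\qquad \Sigma_1(M)=\|[R_1^*,R_2]\|_{H.S.}^2,$$ where $\|\cdot\|_{H.S.}$ is the Hilbert–Schmidt norm. Higher invariants for $M=[p]$, $p\neq0$ a homogeneous polynomial: let $A^n$ ($n\ge 0$) be the $(n+1)\times(n+1)$ matrix with entries $a_{i,l}=\langle p z^{l}w^{n-l},\,p z^{i}w^{n-i}\rangle$, $0\le i,l\le n$ (a Toeplitz matrix; $a_{i,l}=\langle pw^{i-l},pz^{i-l}\rangle$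 for $i\ge l$). Let $A^n_{i,l}$ be the (signed) cofactor of the entry of $A^n$ in row $i$, column $l$ (rows and columns indexed from $0$; $A^0_{0,0}=1$), and let $D_0=1$, $D_n=\det A^{n-1}$ for $n\ge1$. Then $$\varphi_n=\frac{\sum_{l=0}^n A^n_{0,l}\,p\,z^lw^{n-l}}{\sqrt{D_nD_{n+1}}},\qquad \psi_n=\frac{\sum_{l=0}^n A^n_{n,l}\,p\,z^lw^{n-l}}{\sqrt{D_nD_{n+1}}},\qquad n\ge0,$$ are orthonormal bases of $M\ominus zM$ and $M\ominus wM$, respectively, each $\varphi_n,\psi_n$ being homogeneous of degree $n+\deg p$. For $j\ge 2$ one defines $$\Sigma_j(M)=\sum_{n=0}^\infty |\langle w^j\varphi_n, z^j\psi_n\rangle|^2,$$ and this formula also holds for $j=0,1$. Core operator: let $K^M(\lambda,\cdot)$ be the reproducing kernel of $M$ at $\lambda=(\lambda_1,\lambda_2)$ and $G^M(\lambda,(z,w))=(1-\overline{\lambda_1}z)(1-\overline{\lambda_2}w)K^M(\lambda,(z,w))$. The core operator $C^M$ on $H^2(\mathbb D^2)$ is $C^Mf(z,w)=\int_{\mathbb T^2}G^M(\lambda,(z,w))f(\lambda)\,dm(\lambda)$, with $m$ normalized Lebesgue measure on $\mathbb T^2$. Equivalently, $C^M$ is $0$ on $M^\perp$ and equals $I-R_1R_1^*-R_2R_2^*+R_1R_2R_1^*R_2^*$ on $M$. *)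

(* Defs.v *)
From mathcomp Require Import all_boot all_order all_algebra.
From mathcomp Require Export complex.
From mathcomp Require Import all_classical all_reals.
From mathcomp Require Import ereal topology normedtype sequences esum.
Import Order.TTheory GRing.Theory Num.Theory.
Import numFieldNormedType.Exports.
Set Implicit Arguments.
Unset Strict Implicit.
Unset Printing Implicit Defensive.
Local Open Scope classical_set_scope.
Local Open Scope ring_scope.

(* An element of H^2(D^2) is represented by its Taylor coefficients: f (a, b) is the coefficient of
   z^a w^b, so that H^2(D^2) is the set of square-summable families and the
   monomials are orthonormal.  Addition, subtraction and scaling are the
   pointwise library ones. *)
Notation family R := (nat * nat -> R[i]).

Section Bidisk.
Variable R : realType.
Implicit Types (f g h e : family R) (M : set (family R)).
Implicit Types (S T : family R -> family R) (p q : {poly {poly R[i]}}).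

Definition hnorm2 f : \bar R :=
  \esum_(ab in [set: nat * nat]) (ComplexField.Normc.normc (f ab) ^+ 2)%:E.

Definition H2 : set (family R) := [set f | (hnorm2 f < +oo)%E].

(* Meaningful only on [H2]. *)
Definition hnorm f : R := Num.sqrt (fine (hnorm2 f)).

(* Linear in f, antilinear in g.  For f, g in [H2] the double series converges
   absolutely, so it may be summed over growing squares, separately in real and
   imaginary part. *)
Definition inner f g : R[i] :=
  let s n := \sum_(a < n) \sum_(b < n)
               f (val a, val b) * Num.conj (g (val a, val b)) in
  Complex (limn (fun n => complex.Re (s n))) (limn (fun n => complex.Im (s n))).

(* C[z,w] is {poly {poly C}}: the inner variable is z, the outer one is w. *)
Definition zvar : {poly {poly R[i]}} := 'X%:P.
Definition wvar : {poly {poly R[i]}} := 'X.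
Definition coefs p : family R := fun ab => p`_ab.2`_ab.1.

Definition submodule p : set (family R) :=
  [set f | H2 f /\
    forall eps : R, 0 < eps -> exists q, hnorm (f - coefs (p * q)) < eps].

Definition mulz f : family R :=
  fun ab => if ab.1 is a.+1 then f (a, ab.2) else 0.
Definition mulw f : family R :=
  fun ab => if ab.2 is b.+1 then f (ab.1, b) else 0.

(* An operator on a closed subspace M is represented by a map T on all
   families that sends M to itself; only its values on M matter.  [adj M T] is
   the adjoint of T as an operator on M, so R_1^* and R_2^* are [adj M mulz]
   and [adj M mulw]. *)
Definition adj M T g : family R :=
  xget 0 [set h | M h /\ forall f, M f -> inner (T f) g = inner f h].

Definition comm S T f : family R := S (T f) - T (S f).

Definition orthonormal_basis M (E : set (family R)) : Prop :=
  [/\ E `<=` M,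
      forall e e', E e -> E e' -> inner e e' = (`[< e = e' >])%:R
    & forall f, M f -> (forall e, E e -> inner f e = 0) -> f = 0].

(* Squared Hilbert-Schmidt norm of T on M, possibly infinite.  It does not
   depend on the chosen basis. *)
Definition hs2 M T : \bar R :=
  \esum_(e in xget set0 [set E | orthonormal_basis M E])
     (hnorm (T e) ^+ 2)%:E.

(* [gram p n] is A^n, with rows and columns indexed by 0..n. *)
Definition gram p n : 'M[R[i]]_n.+1 :=
  \matrix_(i, l) inner (coefs (p * zvar ^+ l * wvar ^+ (n - l)))
                       (coefs (p * zvar ^+ i * wvar ^+ (n - i))).

Definition gramdet p n : R[i] := if n is m.+1 then \det (gram p m) else 1.

Definition phi p n : family R :=
  (sqrtC (gramdet p n * gramdet p n.+1))^-1 *: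
  \sum_(l < n.+1) cofactor (gram p n) ord0 l *:
                    coefs (p * zvar ^+ l * wvar ^+ (n - l)).

Definition psi p n : family R :=
  (sqrtC (gramdet p n * gramdet p n.+1))^-1 *:
  \sum_(l < n.+1) cofactor (gram p n) ord_max l *:
                    coefs (p * zvar ^+ l * wvar ^+ (n - l)).

(* The invariants of [submodule p]; intended for p homogeneous and nonzero. *)
Definition Sigma p (j : nat) : \bar R :=
  let M := submodule p in
  match j with
  | 0 => hs2 M (comm (adj M mulw) mulw \o comm (adj M mulz) mulz)
  | 1 => hs2 M (comm (adj M mulz) mulw)
  | _ => \sum_(0 <= n <oo)
           (ComplexField.Normc.normc
              (inner (iter j mulw (phi p n)) (iter j mulz (psi p n))) ^+ 2)%:E
  end%E.

Definition proj M f : family R :=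
  xget 0 [set g | M g /\ forall h, M h -> inner (f - g) h = 0].

(* The core operator: I - R1 R1^* - R2 R2^* + R1 R2 R1^* R2^* on M, and 0 on
   the orthogonal complement of M. *)
Definition core M f : family R :=
  let g := proj M f in
  g - mulz (adj M mulz g) - mulw (adj M mulw g)
    + mulz (mulw (adj M mulz (adj M mulw g))).

Definition eigenspace_H2 T (lam : R[i]) : set (family R) :=
  [set f | H2 f /\ T f = lam *: f].

(* The linear subspace V has dimension d: it has a basis of d elements. *)
Definition has_dim (V : set (family R)) (d : nat) : Prop :=
  exists e : 'I_d -> family R, (forall i, V (e i)) /\
    forall f, V f -> exists! c : 'I_d -> R[i], f = \sum_i c i *: e i.

Definition Mpoly (k : nat) : {poly {poly R[i]}} := zvar ^+ k - wvar ^+ k.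

End Bidisk.

(* Main.v *)
(* Grade the bidisk by total degree and by the residues (r, s) of the two exponents mod k.  A vector
   of M = [z^k - w^k] sums to 0 over each antidiagonal of each residue class, and a vector of H^2
   orthogonal to M is constant there, so the projection onto M subtracts the mean over the class.
   This gives R_1^* and R_2^* in closed form.

   The core operator only sees the exponents divisible by k, and there it acts by a formula in
   which k no longer occurs (on z^(ki) w^(kl) written as (i, l)); hence its nonzero spectrum is
   independent of k.

   [R_1^*, R_2] g depends only on the coefficients of w^(kN-1) in g, and Parseval turns its
   Hilbert-Schmidt norm into sums of squared norms of projected monomials, of value 1 - 1/N; the
   total is the sum of 1/(m+2)^2.  For j >= 2 the Gram system is a discrete Laplacian, solved by a
   linear function, so phi_n and psi_n are explicit; with m = n / k, the n-th inner product vanishes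
   unless k | n + j, and is then (m+2-q)_+ / ((m+1)(m+2)) in modulus with q the ceiling of
   j / k.  So Sigma_j = Sigma_1 exactly when q = 1. *)
Require Import Defs.
From mathcomp Require Import all_boot all_order all_algebra.
From mathcomp Require Import all_classical all_reals.
From mathcomp Require Import ereal topology normedtype sequences esum.
From mathcomp Require Import ring lra zify.
Import Order.TTheory GRing.Theory Num.Theory.
Import numFieldNormedType.Exports.
Set Implicit Arguments.
Unset Strict Implicit.
Unset Printing Implicit Defensive.
Local Open Scope classical_set_scope.
Local Open Scope ring_scope.

Local Notation family R := (nat * nat -> R[i]).

(** * Sums over growing squares *)

(** [adj], [proj] and the basis in [hs2] are choices made by [xget], so none of them can be computed
    before existence is known; this is why the projection theorem, orthonormal bases and Parseval
    precede any use of z^k - w^k. The closed form of R_1^* comes from one observation. The backward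
    shift in z carries residue classes to residue classes, and a class carried over whole still sums
    to 0. Only the class of z-exponents divisible by k is not carried over whole: it loses its entry
    at z-exponent 0. Projecting back spreads that lost entry evenly over the remaining ones. R_2^*
    is the mirror image. The number of entries over which it is spread involves floor(b/k) for the
    w-exponent b, which jumps only at multiples of k. Elsewhere the corrections cancel, both in
    [R_1^*, R_2] and in the core operator, and this confines both computations to a sublattice.
    Square sums are the common currency: [hnorm2] is a sum over a set and [inner] a limit over
    squares, and both are reduced to [sqs]. *)

Definition sqs (V : nmodType) (n : nat) (t : nat * nat -> V) : V :=
  \sum_(a < n) \sum_(b < n) t (val a, val b).

Section SquareSums.
Variable V : nmodType.
Implicit Types t : nat * nat -> V.

Lemma eq_sqs n t t' : (forall x, (x.1 < n)%N -> (x.2 < n)%N -> t x = t' x) ->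
  sqs n t = sqs n t'.
Proof. by move=> e; apply: eq_bigr => a _; apply: eq_bigr => b _; apply: e => /=. Qed.

Lemma sqsD n t t' : sqs n (fun x => t x + t' x) = sqs n t + sqs n t'.
Proof. by rewrite /sqs -big_split/=; apply: eq_bigr => a _; rewrite -big_split. Qed.

Lemma sqs0 n : sqs n (fun=> 0 : V) = 0.
Proof. by rewrite /sqs big1// => a _; rewrite big1. Qed.

Lemma sqs_sum (I : Type) (r : seq I) (P : pred I) n (F : I -> nat * nat -> V) :
  sqs n (fun x => \sum_(i <- r | P i) F i x) = \sum_(i <- r | P i) sqs n (F i).
Proof.
rewrite /sqs [RHS]exchange_big; apply: eq_bigr => a _.
by rewrite [RHS]exchange_big.
Qed.

Lemma sqs_morph (W : nmodType) (g : V -> W) n t :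
  {morph g : x y / x + y} -> g 0 = 0 -> g (sqs n t) = sqs n (g \o t).
Proof.
move=> gD g0; rewrite /sqs (big_morph g gD g0); apply: eq_bigr => a _.
by rewrite (big_morph g gD g0).
Qed.

Lemma sqs_widen n m t : (n <= m)%N ->
  sqs n t = sqs m (fun x => if (x.1 < n)%N && (x.2 < n)%N then t x else 0).
Proof.
move=> nm; rewrite /sqs (big_ord_widen m (fun a => \sum_(b < n) t (a, val b)))//.
rewrite big_mkcond; apply: eq_bigr => a _ /=.
case: ifP => an; last by rewrite big1.
by rewrite (big_ord_widen m (fun b => t (val a, b)))// big_mkcond.
Qed.

Lemma sqs_supp n m t : (n <= m)%N ->
  (forall x, ~~ ((x.1 < n)%N && (x.2 < n)%N) -> t x = 0) -> sqs m t = sqs n t.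
Proof.
move=> nm t0; rewrite (sqs_widen t nm); apply: eq_sqs => x _ _.
by case: ifP => // /negbT/t0.
Qed.

Lemma sqs_pick n x t : (x.1 < n)%N -> (x.2 < n)%N ->
  sqs n (fun y => if y == x then t y else 0) = t x.
Proof.
case: x => a b /= an bn; rewrite /sqs (bigD1 (Ordinal an))//= (bigD1 (Ordinal bn))//= eqxx.
rewrite big1 => [|j /eqP jb]; last first.
  by case: eqP => // -[jE]; case: jb; apply: val_inj.
rewrite big1 ?addr0// => i /eqP ia; rewrite big1// => j _.
by case: eqP => // -[iE _]; case: ia; apply: val_inj.
Qed.

End SquareSums.

Lemma sqsZ (V : pzRingType) n c (t : nat * nat -> V) :
  sqs n (fun x => c * t x) = c * sqs n t.
Proof. by rewrite (@sqs_morph _ _ (fun v => c * v))// ?mulr0// => x y; rewrite mulrDr. Qed.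

Section RealSquareSums.
Variable R : realType.
Implicit Types t : nat * nat -> R.

Lemma le_sqs n t t' : (forall x, t x <= t' x) -> sqs n t <= sqs n t'.
Proof. by move=> tt'; apply: ler_sum => a _; apply: ler_sum. Qed.

Lemma sqs_ge0 n t : (forall x, 0 <= t x) -> 0 <= sqs n t.
Proof. by move=> t0; apply: sumr_ge0 => a _; apply: sumr_ge0. Qed.

Lemma sqs_mono n m t : (forall x, 0 <= t x) -> (n <= m)%N -> sqs n t <= sqs m t.
Proof. by move=> t0 nm; rewrite (sqs_widen t nm); apply: le_sqs => x; case: ifP. Qed.

Lemma sqs_le_esum n t : (forall x, 0 <= t x) ->
  ((sqs n t)%:E <= \esum_(x in [set: nat * nat]) (t x)%:E)%E.
Proof.
move=> t0; pose L := [seq (a, b) | a <- index_iota 0 n, b <- index_iota 0 n].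
have uL : uniq L by apply: allpairs_uniq; rewrite ?iota_uniq// => -[? ?] [? ?].
apply: esum_ge; exists [set` L]; first by split => //; exact: finite_seq.
rewrite -fsbig_seq// /L big_allpairs /sqs -sumEFin big_mkord.
by apply: lee_sum => a _; rewrite -sumEFin big_mkord.
Qed.

(** A finite index set lies in some square. Each of its terms is rewritten as a square sum with a
    single nonzero entry, after which the comparison with [sqs n t] is pointwise. *)
Lemma esum_le_sqs t B : (forall x, 0 <= t x) -> (forall n, sqs n t <= B) ->
  (\esum_(x in [set: nat * nat]) (t x)%:E <= B%:E)%E.
Proof.
move=> t0 tB; apply: ge_ereal_sup => _ [X [Xfin _] <-].
rewrite fsbig_finite//= sumEFin lee_fin.
have := finmap.fset_uniq (fset_set X); set L := finmap.enum_fset _ => uL.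
pose n := (\max_(x <- L) maxn x.1 x.2).+1.
have inn x : x \in L -> (x.1 < n)%N && (x.2 < n)%N.
  move=> xX; rewrite /n !ltnS -geq_max.
  by apply: (leq_bigmax_seq (F := fun x : nat * nat => maxn x.1 x.2) (P := xpredT)) xX _.
apply: le_trans (tB n).
rewrite big_seq (eq_bigr (fun x => sqs n (fun y => if y == x then t y else 0))); last first.
  by move=> x /inn /andP[? ?]; rewrite sqs_pick.
rewrite -big_seq -sqs_sum; apply: le_sqs => y.
have [yX|yX] := boolP (y \in L).
  rewrite (bigD1_seq y)//= eqxx big1 ?addr0// => i iy.
  by rewrite eq_sym (negbTE iy).
rewrite big_seq big1// => x xX; case: eqP => // yx.
by rewrite yx xX in yX.
Qed.

Lemma sqs_cvg_le t (l : R) : (forall x, 0 <= t x) ->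
  (fun n => sqs n t) @ \oo --> l -> forall n, sqs n t <= l.
Proof.
move=> t0 tl n; rewrite -(cvg_lim (@Rhausdorff R) tl).
apply: nondecreasing_cvgn_le; last by apply/cvg_ex; exists l.
by move=> a b ab; apply: sqs_mono.
Qed.

Lemma sqs_bounded_cvg t B : (forall x, 0 <= t x) -> (forall n, sqs n t <= B) ->
  cvgn (fun n => sqs n t).
Proof.
move=> t0 tB; apply: nondecreasing_is_cvgn.
  by move=> a b ab; apply: sqs_mono.
by exists B => _ [n _ <-].
Qed.

Lemma esum_sqs_lim t (l : R) : (forall x, 0 <= t x) -> (fun n => sqs n t) @ \oo --> l ->
  (\esum_(x in [set: nat * nat]) (t x)%:E = l%:E)%E.
Proof.
move=> t0 tl; apply/eqP; rewrite eq_le esum_le_sqs//=; last exact: sqs_cvg_le.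
set e := esum _ _; have ege n : ((sqs n t)%:E <= e)%E by exact: sqs_le_esum.
case: e ege => [r| |] ege; rewrite ?leey//; last by have := ege 0%N.
rewrite lee_fin -(cvg_lim (@Rhausdorff R) tl); apply: limr_le.
  by apply/cvg_ex; exists l.
by apply: nearW => n; have := ege n; rewrite lee_fin.
Qed.

(** Write r = (r + t) - t: both r + t and t are nonnegative with bounded square sums, so monotone
    convergence applies to each. *)
Lemma sqs_dominated_cvg (r t : nat * nat -> R) B : (forall x, `|r x| <= t x) ->
  (forall n, sqs n t <= B) -> cvgn (fun n => sqs n r).
Proof.
move=> rt tB; have t0 x : 0 <= t x by apply: le_trans (rt x).
have -> : (fun n => sqs n r) = (fun n => sqs n (fun x => r x + t x) - sqs n t).
  by apply/funext => n; rewrite sqsD addrK.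
apply: is_cvgB; last exact: sqs_bounded_cvg tB.
apply: (@sqs_bounded_cvg _ (B + B)) => [x|n].
  by have := rt x; rewrite ler_norml => /andP[+ _]; rewrite -subr_ge0 opprK.
rewrite sqsD lerD// (le_trans _ (tB n))//; apply: le_sqs => x.
exact: le_trans (ler_norm _) (rt x).
Qed.

End RealSquareSums.

(** * The inner product *)

Section ComplexLimits.
Variable R : realType.
Implicit Types (z w : R[i]) (u v : nat -> R[i]).

Definition nsq z : R := complex.Re z ^+ 2 + complex.Im z ^+ 2.

Lemma normc_sq z : ComplexField.Normc.normc z ^+ 2 = nsq z.
Proof. by case: z => a b; rewrite /nsq /= sqr_sqrtr// addr_ge0 ?sqr_ge0. Qed.

Lemma conjE z : Num.conj z = Complex (complex.Re z) (- complex.Im z).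
Proof. by case: z. Qed.

Lemma nsq_ge0 z : 0 <= nsq z.
Proof. by rewrite addr_ge0 ?sqr_ge0. Qed.

Lemma nsq0 : nsq 0 = 0.
Proof. by rewrite /nsq /= expr0n addr0. Qed.

Lemma nsq1 : nsq 1 = 1.
Proof. by rewrite /nsq /= expr1n expr0n addr0. Qed.

Lemma nsq_eq0 z : (nsq z == 0) = (z == 0).
Proof.
case: z => a b; rewrite /nsq paddr_eq0 ?sqr_ge0//= !sqrf_eq0.
by rewrite eq_complex.
Qed.

Lemma nsqM z w : nsq (z * w) = nsq z * nsq w.
Proof. by case: z w => a b [c d]; rewrite /nsq /=; ring. Qed.

Lemma nsqN z : nsq (- z) = nsq z.
Proof. by case: z => a b; rewrite /nsq /= !sqrrN. Qed.

Lemma nsqJ z : nsq (Num.conj z) = nsq z.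
Proof. by rewrite conjE /nsq /= sqrrN. Qed.

Lemma nsqV z : nsq z^-1 = (nsq z)^-1.
Proof.
have [->|z0] := eqVneq z 0; first by rewrite invr0 nsq0 invr0.
have nz : nsq z != 0 by rewrite nsq_eq0.
by apply: (mulfI nz); rewrite -nsqM !divff// nsq1.
Qed.

Lemma nsqD_le z w : nsq (z + w) <= 2 * nsq z + 2 * nsq w.
Proof.
case: z w => a b [c d]; rewrite /nsq /=.
by have := sqr_ge0 (a - c); have := sqr_ge0 (b - d); nra.
Qed.

Lemma mul_conj_nsq z : z * Num.conj z = Complex (nsq z) 0.
Proof. by rewrite conjE; case: z => a b; rewrite /nsq; congr Complex => /=; ring. Qed.

(** Convergence is split into real and imaginary parts because [inner] is built from two real
    limits. *)
Definition ccvg u (l : R[i]) : Prop :=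
  (fun n => complex.Re (u n)) @ \oo --> complex.Re l /\
  (fun n => complex.Im (u n)) @ \oo --> complex.Im l.

Lemma ccvgD u v l m : ccvg u l -> ccvg v m -> ccvg (fun n => u n + v n) (l + m).
Proof.
move=> [ur ui] [vr vi]; split.
  rewrite (_ : complex.Re _ = complex.Re l + complex.Re m); last by case: (l) (m) => ? ? [].
  rewrite (_ : (fun _ => _) = (fun n => complex.Re (u n) + complex.Re (v n))).
    exact: cvgD.
  by apply/funext => n; case: (u n) (v n) => ? ? [].
rewrite (_ : complex.Im _ = complex.Im l + complex.Im m); last by case: (l) (m) => ? ? [].
rewrite (_ : (fun _ => _) = (fun n => complex.Im (u n) + complex.Im (v n))).
  exact: cvgD.
by apply/funext => n; case: (u n) (v n) => ? ? [].
Qed.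

Lemma ccvgZ c u l : ccvg u l -> ccvg (fun n => c * u n) (c * l).
Proof.
case: c => x y [ur ui]; split.
  rewrite (_ : complex.Re _ = x * complex.Re l - y * complex.Im l); last by case: (l).
  rewrite (_ : (fun _ => _) = (fun n => x * complex.Re (u n) - y * complex.Im (u n))).
    by apply: cvgB; apply: cvgM => //; exact: cvg_cst.
  by apply/funext => n; case: (u n).
rewrite (_ : complex.Im _ = x * complex.Im l + y * complex.Re l); last by case: (l).
rewrite (_ : (fun _ => _) = (fun n => x * complex.Im (u n) + y * complex.Re (u n))).
  by apply: cvgD; apply: cvgM => //; exact: cvg_cst.
by apply/funext => n; case: (u n).
Qed.

Lemma ccvgJ u l : ccvg u l -> ccvg (fun n => Num.conj (u n)) (Num.conj l).
Proof.
move=> [ur ui]; split.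
  rewrite (_ : complex.Re _ = complex.Re l); last by rewrite conjE.
  by rewrite (_ : (fun _ => _) = (fun n => complex.Re (u n)))//; apply/funext => n; rewrite conjE.
rewrite (_ : complex.Im _ = - complex.Im l); last by rewrite conjE.
rewrite (_ : (fun _ => _) = (fun n => - complex.Im (u n))); first exact: cvgN.
by apply/funext => n; rewrite conjE.
Qed.

Lemma ccvg_near_cst u l N : (forall n, (N <= n)%N -> u n = l) -> ccvg u l.
Proof.
by move=> uE; split; apply: cvg_near_cst; exists N => // n /= Nn; rewrite uE.
Qed.

End ComplexLimits.

Section InnerProduct.
Variable R : realType.
Implicit Types f g h : family R.

(** Estimates are made with the squared norm, which avoids square roots; the triangle inequality is
    replaced by [nrm2D_le], hence the factors 2 and 4 in what follows. Like [hnorm], it is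
    meaningful on [H2] only. *)
Definition nrm2 f : R := fine (hnorm2 f).

Lemma hnorm2_nsq f : hnorm2 f = (\esum_(x in [set: nat * nat]) (nsq (f x))%:E)%E.
Proof. by apply: eq_esum => x _; rewrite normc_sq. Qed.

Lemma H2P f : H2 f <-> exists B, forall n, sqs n (fun x => nsq (f x)) <= B.
Proof.
rewrite /H2 /= hnorm2_nsq; split => [fin|[B fB]].
  have := fun n => @sqs_le_esum R n (fun x => nsq (f x)) (fun x => nsq_ge0 _).
  case: (esum _ _) fin => // [r _ le|]; last by move=> _ /(_ 0%N).
  by exists r => n; have := le n; rewrite lee_fin.
apply: le_lt_trans (esum_le_sqs _ fB) _; first by move=> x; exact: nsq_ge0.
exact: ltry.
Qed.

Lemma nrm2_cvg f : H2 f -> (fun n => sqs n (fun x => nsq (f x))) @ \oo --> nrm2 f.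
Proof.
move=> /H2P[B fB]; have n0 x : 0 <= nsq (f x) by exact: nsq_ge0.
have /cvg_ex[l fl] := sqs_bounded_cvg n0 fB.
by rewrite /nrm2 hnorm2_nsq (esum_sqs_lim n0 fl).
Qed.

Lemma hnorm2E f : H2 f -> hnorm2 f = (nrm2 f)%:E.
Proof.
by move=> /nrm2_cvg fl; rewrite hnorm2_nsq (esum_sqs_lim _ fl)// => x; exact: nsq_ge0.
Qed.

Lemma sqs_le_nrm2 f n : H2 f -> sqs n (fun x => nsq (f x)) <= nrm2 f.
Proof. by move=> /nrm2_cvg /sqs_cvg_le; apply => x; exact: nsq_ge0. Qed.

Lemma nrm2_ge0 f : 0 <= nrm2 f.
Proof. by rewrite fine_ge0// hnorm2_nsq esum_ge0// => x _; rewrite lee_fin nsq_ge0. Qed.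

Lemma sqs_nrm2_le f B : (forall n, sqs n (fun x => nsq (f x)) <= B) ->
  H2 f /\ nrm2 f <= B.
Proof.
move=> fB; have fH : H2 f by apply/H2P; exists B.
split=> //; rewrite -lee_fin -hnorm2E// hnorm2_nsq.
by apply: esum_le_sqs fB => x; exact: nsq_ge0.
Qed.

Lemma nsq_le_nrm2 f x : H2 f -> nsq (f x) <= nrm2 f.
Proof.
move=> fH; apply: le_trans (sqs_le_nrm2 (maxn x.1 x.2).+1 fH).
rewrite -[leLHS](@sqs_pick R (maxn x.1 x.2).+1 x (fun x => nsq (f x)));
  rewrite ?ltnS ?leq_maxl ?leq_maxr//.
by apply: le_sqs => y; case: ifP => // _; exact: nsq_ge0.
Qed.

Lemma nrm2_eq0 f : H2 f -> nrm2 f = 0 -> f = 0.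
Proof.
move=> fH f0; apply/funext => x; apply/eqP; rewrite -nsq_eq0.
by rewrite eq_le nsq_ge0 andbT -[leRHS]f0 nsq_le_nrm2.
Qed.

Lemma H2_0 : H2 (0 : family R).
Proof.
by apply/H2P; exists 0 => n; rewrite (eq_sqs (t' := fun=> 0)) ?sqs0// => x _ _; rewrite nsq0.
Qed.

Lemma H2D f g : H2 f -> H2 g -> H2 (f + g).
Proof.
move=> fH gH; apply/H2P; exists (2 * nrm2 f + 2 * nrm2 g) => n.
apply: (@le_trans _ _ (sqs n (fun x => 2 * nsq (f x) + 2 * nsq (g x)))).
  by apply: le_sqs => x; exact: nsqD_le.
by rewrite sqsD !sqsZ lerD// ler_pM2l// sqs_le_nrm2.
Qed.

Lemma H2Z c f : H2 f -> H2 (c *: f).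
Proof.
move=> fH; apply/H2P; exists (nsq c * nrm2 f) => n.
rewrite (eq_sqs (t' := fun x => nsq c * nsq (f x))); last by move=> x _ _; rewrite -nsqM.
by rewrite sqsZ ler_wpM2l ?nsq_ge0// sqs_le_nrm2.
Qed.

Lemma H2N f : H2 f -> H2 (- f).
Proof. by move=> fH; rewrite -scaleN1r; exact: H2Z. Qed.

Lemma H2B f g : H2 f -> H2 g -> H2 (f - g).
Proof. by move=> fH gH; apply: H2D => //; exact: H2N. Qed.

Lemma H2_sum (I : Type) (r : seq I) (P : pred I) (F : I -> family R) :
  (forall i, P i -> H2 (F i)) -> H2 (\sum_(i <- r | P i) F i).
Proof. by move=> FH; apply: big_ind => //; [exact: H2_0|exact: H2D]. Qed.

Lemma inner_lim f g l : ccvg (fun n => sqs n (fun x => f x * Num.conj (g x))) l ->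
  inner f g = l.
Proof.
move=> [fr fi]; apply/eqP; rewrite eq_complex /inner /=.
by apply/andP; split; apply/eqP; apply: cvg_lim => //; exact: Rhausdorff.
Qed.

(** [limn] means something only for convergent sequences, so every algebraic law of [inner] rests on
    this lemma. Both parts of the summand are dominated through |x y| <= (x^2 + y^2) / 2. *)
Lemma inner_cvg f g : H2 f -> H2 g ->
  ccvg (fun n => sqs n (fun x => f x * Num.conj (g x))) (inner f g).
Proof.
move=> fH gH; have bd n : sqs n (fun x => nsq (f x) + nsq (g x)) <= nrm2 f + nrm2 g.
  by rewrite sqsD lerD// sqs_le_nrm2.
have am (x y : R) : `|x * y| <= (x ^+ 2 + y ^+ 2) / 2.
  by rewrite ler_norml; apply/andP; split; have := sqr_ge0 (x - y); have := sqr_ge0 (x + y); lra.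
have Rem (z w : R[i]) : `|complex.Re (z * Num.conj w)| <= nsq z + nsq w.
  rewrite conjE; case: z w => a b [c d]; rewrite /nsq /= mulrN opprK.
  apply: le_trans (ler_normD _ _) _.
  by have := am a c; have := am b d; have := sqr_ge0 a; have := sqr_ge0 b;
    have := sqr_ge0 c; have := sqr_ge0 d; lra.
have Imm (z w : R[i]) : `|complex.Im (z * Num.conj w)| <= nsq z + nsq w.
  rewrite conjE; case: z w => a b [c d]; rewrite /nsq /= mulrN.
  apply: le_trans (ler_normD _ _) _; rewrite normrN.
  by have := am a d; have := am b c; have := sqr_ge0 a; have := sqr_ge0 b;
    have := sqr_ge0 c; have := sqr_ge0 d; lra.
have /cvg_ex[x fx] := @sqs_dominated_cvg _ (fun x => complex.Re (f x * Num.conj (g x)))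
  _ _ (fun x => Rem _ _) bd.
have /cvg_ex[y fy] := @sqs_dominated_cvg _ (fun x => complex.Im (f x * Num.conj (g x)))
  _ _ (fun x => Imm _ _) bd.
suff fl : ccvg (fun n => sqs n (fun x => f x * Num.conj (g x))) (Complex x y).
  by rewrite (inner_lim fl).
split=> /=.
  rewrite (_ : (fun _ => _) = (fun n => sqs n (fun x => complex.Re (f x * Num.conj (g x)))))//.
  by apply/funext => n; rewrite (sqs_morph (g := @complex.Re R))// => -[? ?] [].
rewrite (_ : (fun _ => _) = (fun n => sqs n (fun x => complex.Im (f x * Num.conj (g x)))))//.
by apply/funext => n; rewrite (sqs_morph (g := @complex.Im R))// => -[? ?] [].
Qed.

Lemma innerDl f g h : H2 f -> H2 g -> H2 h -> inner (f + g) h = inner f h + inner g h.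
Proof.
move=> fH gH hH; apply: inner_lim.
rewrite (_ : (fun _ => _) = (fun n => sqs n (fun x => f x * Num.conj (h x)) +
   sqs n (fun x => g x * Num.conj (h x)))).
  by apply: ccvgD; exact: inner_cvg.
by apply/funext => n; rewrite -sqsD; apply: eq_sqs => x _ _; rewrite -mulrDl.
Qed.

Lemma innerZl c f h : H2 f -> H2 h -> inner (c *: f) h = c * inner f h.
Proof.
move=> fH hH; apply: inner_lim.
rewrite (_ : (fun _ => _) = (fun n => c * sqs n (fun x => f x * Num.conj (h x)))).
  by apply: ccvgZ; exact: inner_cvg.
by apply/funext => n; rewrite -sqsZ; apply: eq_sqs => x _ _; rewrite mulrA.
Qed.

Lemma innerC f g : H2 f -> H2 g -> inner g f = Num.conj (inner f g).
Proof.
move=> fH gH; apply: inner_lim.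
rewrite (_ : (fun _ => _) = (fun n => Num.conj (sqs n (fun x => f x * Num.conj (g x))))).
  by apply: ccvgJ; exact: inner_cvg.
apply/funext => n; rewrite (sqs_morph (g := Num.conj)) ?rmorph0//; last exact: rmorphD.
by apply: eq_sqs => x _ _ /=; rewrite rmorphM/= conjCK mulrC.
Qed.

Lemma innerNl f h : H2 f -> H2 h -> inner (- f) h = - inner f h.
Proof. by move=> fH hH; rewrite -scaleN1r innerZl// mulN1r. Qed.

Lemma innerBl f g h : H2 f -> H2 g -> H2 h -> inner (f - g) h = inner f h - inner g h.
Proof. by move=> fH gH hH; rewrite innerDl ?innerNl//; exact: H2N. Qed.

Lemma innerDr f g h : H2 f -> H2 g -> H2 h -> inner h (f + g) = inner h f + inner h g.
Proof.
move=> fH gH hH; rewrite innerC ?innerDl//; last exact: H2D.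
by rewrite rmorphD/= -!innerC.
Qed.

Lemma innerZr c f h : H2 f -> H2 h -> inner h (c *: f) = Num.conj c * inner h f.
Proof.
move=> fH hH; rewrite innerC ?innerZl//; last exact: H2Z.
by rewrite rmorphM/= -innerC.
Qed.

Lemma innerNr f h : H2 f -> H2 h -> inner h (- f) = - inner h f.
Proof. by move=> fH hH; rewrite -scaleN1r innerZr// rmorphN1 mulN1r. Qed.

Lemma innerBr f g h : H2 f -> H2 g -> H2 h -> inner h (f - g) = inner h f - inner h g.
Proof. by move=> fH gH hH; rewrite innerDr ?innerNr//; exact: H2N. Qed.

Lemma inner0l h : H2 h -> inner 0 h = 0.
Proof. by move=> hH; rewrite -(scale0r (0 : family R)) innerZl ?mul0r//; exact: H2_0. Qed.

Lemma inner_suml (I : Type) (r : seq I) (P : pred I) (F : I -> family R) h :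
  H2 h -> (forall i, P i -> H2 (F i)) ->
  inner (\sum_(i <- r | P i) F i) h = \sum_(i <- r | P i) inner (F i) h.
Proof.
move=> hH FH; elim: r => [|i r IH]; first by rewrite !big_nil inner0l.
rewrite !big_cons; case: ifP => // Pi.
by rewrite innerDl ?IH//; [exact: FH|exact: H2_sum].
Qed.

Lemma inner_self f : H2 f -> inner f f = Complex (nrm2 f) 0.
Proof.
move=> fH; apply: inner_lim; split => /=.
  rewrite (_ : (fun _ => _) = (fun n => sqs n (fun x => nsq (f x)))); first exact: nrm2_cvg.
  apply/funext => n; rewrite (sqs_morph (g := @complex.Re R))//; last by move=> [? ?] [].
  by apply: eq_sqs => x _ _ /=; rewrite mul_conj_nsq.
rewrite (_ : (fun _ => _) = (fun n => 0)); first exact: cvg_cst.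
apply/funext => n; rewrite (sqs_morph (g := @complex.Im R))//; last by move=> [? ?] [].
by rewrite (eq_sqs (t' := fun=> 0)) ?sqs0// => x _ _ /=; rewrite mul_conj_nsq.
Qed.

Lemma nrm2E f : H2 f -> nrm2 f = complex.Re (inner f f).
Proof. by move=> fH; rewrite inner_self. Qed.

Lemma inner_fin f g n : (forall x, ~~ ((x.1 < n)%N && (x.2 < n)%N) -> f x * Num.conj (g x) = 0) ->
  inner f g = sqs n (fun x => f x * Num.conj (g x)).
Proof.
move=> fg0; apply: inner_lim; apply: (@ccvg_near_cst _ _ _ n) => m nm.
exact: sqs_supp.
Qed.

Lemma H2_fin f n : (forall x, ~~ ((x.1 < n)%N && (x.2 < n)%N) -> f x = 0) -> H2 f.
Proof.
move=> f0; apply/H2P; exists (sqs n (fun x => nsq (f x))) => m.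
have [mn|/ltnW nm] := leqP m n; first by apply: sqs_mono => // x; exact: nsq_ge0.
by rewrite (sqs_supp nm)// => x /f0 ->; rewrite nsq0.
Qed.

Definition dlt (x : nat * nat) : family R := fun y => (y == x)%:R.

Lemma H2_dlt x : H2 (dlt x).
Proof.
apply: (@H2_fin _ (maxn x.1 x.2).+1) => y; rewrite /dlt; case: eqP => // ->.
by rewrite !ltnS leq_maxl leq_maxr.
Qed.

Lemma inner_dlt f x : inner f (dlt x) = f x.
Proof.
pose n := (maxn x.1 x.2).+1.
rewrite (@inner_fin _ _ n) => [|y]; last first.
  rewrite /dlt; case: eqP => [->|]; last by rewrite conjC0 mulr0.
  by rewrite !ltnS leq_maxl leq_maxr.
rewrite -[RHS](@sqs_pick _ n x f) ?ltnS ?leq_maxl ?leq_maxr//.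
apply: eq_sqs => y _ _; rewrite /dlt; case: eqP => _; first by rewrite conjC1 mulr1.
by rewrite conjC0 mulr0.
Qed.

End InnerProduct.

(** * Closed subspaces: projections, orthonormal bases, Parseval *)

Section Geometry.
Variable R : realType.
Implicit Types f g h : family R.

Lemma nsqB (z w : R[i]) : nsq (z - w) =
  (complex.Re z - complex.Re w) ^+ 2 + (complex.Im z - complex.Im w) ^+ 2.
Proof. by case: z w => a b [c d]. Qed.

Lemma nrm2_0 : nrm2 (0 : family R) = 0.
Proof. by rewrite nrm2E ?inner0l//; exact: H2_0. Qed.

Lemma nrm2Z c f : H2 f -> nrm2 (c *: f) = nsq c * nrm2 f.
Proof.
move=> fH; have cfH := H2Z c fH.
rewrite nrm2E// innerZl// innerZr// mulrA mul_conj_nsq inner_self//=.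
by rewrite mulr0 subr0.
Qed.

Lemma nrm2N f : H2 f -> nrm2 (- f) = nrm2 f.
Proof. by move=> fH; rewrite -scaleN1r nrm2Z// nsqN nsq1 mul1r. Qed.

Lemma nrm2C f g : H2 f -> H2 g -> nrm2 (f - g) = nrm2 (g - f).
Proof. by move=> fH gH; rewrite -opprB nrm2N//; exact: H2B. Qed.

Lemma nrm2D f g : H2 f -> H2 g ->
  nrm2 (f + g) = nrm2 f + nrm2 g + 2 * complex.Re (inner f g).
Proof.
move=> fH gH; have fgH := H2D fH gH; rewrite nrm2E// innerDl// !innerDr//.
rewrite !inner_self// (innerC fH gH) conjE; case: (inner f g) => a b /=; ring.
Qed.

Lemma nrm2_pythagoras f g : H2 f -> H2 g -> inner f g = 0 -> nrm2 (f + g) = nrm2 f + nrm2 g.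
Proof. by move=> fH gH fg; rewrite nrm2D// fg /= mulr0 addr0. Qed.

Lemma parallelogram f g : H2 f -> H2 g ->
  nrm2 (f - g) = 2 * nrm2 f + 2 * nrm2 g - nrm2 (f + g).
Proof.
move=> fH gH; have gH' := H2N gH.
rewrite !nrm2D// innerNr// nrm2N//; case: (inner f g) => a b /=; ring.
Qed.

Lemma nrm2D_le f g : H2 f -> H2 g -> nrm2 (f + g) <= 2 * nrm2 f + 2 * nrm2 g.
Proof.
by move=> fH gH; have := parallelogram fH gH; have := nrm2_ge0 (f - g); lra.
Qed.

(* Test the minimality against the multiple of [g] that kills the component of [f] along [g]. *)
Lemma nsq_inner_le f g d : H2 f -> H2 g -> (forall c, d <= nrm2 (f - c *: g)) ->
  nsq (inner f g) <= (nrm2 f - d) * nrm2 g.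
Proof.
move=> fH gH dmin; have [g0|g0] := eqVneq (nrm2 g) 0.
  rewrite (nrm2_eq0 gH g0) nrm2_0 mulr0 innerC ?inner0l ?conjC0 ?nsq0//; exact: H2_0.
have gp : 0 < nrm2 g by rewrite lt_neqAle eq_sym g0 nrm2_ge0.
set z := inner f g; have := dmin (z * Complex (nrm2 g)^-1 0).
have cgH := H2Z (z * Complex (nrm2 g)^-1 0) gH.
rewrite nrm2D//; last exact: H2N.
rewrite nrm2N// nrm2Z// innerNr// innerZr// -/z.
set N := nrm2 g in gp g0 *.
rewrite (_ : Num.conj (z * Complex N^-1 0) * z = Complex (nsq z * N^-1) 0); last first.
  rewrite conjE; case: (z) => a b; rewrite /nsq /=.
  by apply/eqP; rewrite eq_complex /=; apply/andP; split; apply/eqP; ring.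
rewrite nsqM {2}/nsq /= expr0n addr0 => le_d.
rewrite -ler_pdivrMr//.
have NV : N^-1 * N = 1 by rewrite mulVf.
have : nsq z * N^-1 ^+ 2 * N = nsq z / N by rewrite -mulrA expr2 -mulrA NV mulr1.
by move: le_d; lra.
Qed.

Lemma cauchy_schwarz f g : H2 f -> H2 g -> nsq (inner f g) <= nrm2 f * nrm2 g.
Proof.
move=> fH gH; have := @nsq_inner_le f g 0 fH gH; rewrite subr0; apply => c.
exact: nrm2_ge0.
Qed.

Lemma real_cauchy_cvg (a e : nat -> R) : e @ \oo --> (0 : R) ->
  (forall n m, (n <= m)%N -> (a n - a m) ^+ 2 <= e n) -> cvgn a.
Proof.
move=> e0 ae; apply: cauchy_cvg; apply: cauchy_exP => eps eps0.
have e20 : 0 < eps ^+ 2 by rewrite exprn_gt0.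
have /cvgrPdist_lt/(_ _ e20)[N _ Ne] := e0.
exists (a N); exists N => // n /= Nn; rewrite /ball /=.
rewrite -(@ltr_pXn2r _ 2)// ?nnegrE ?(ltW eps0)// real_normK ?num_real//.
apply: le_lt_trans (ae _ _ Nn) _.
have := Ne N (leqnn _); rewrite sub0r normrN; apply: le_lt_trans.
exact: ler_norm.
Qed.

Lemma sqs_cvg M (t : nat -> nat * nat -> R) t' : (forall x, t n x @[n --> \oo] --> t' x) ->
  sqs M (t n) @[n --> \oo] --> sqs M t'.
Proof.
move=> tt'; apply: cvg_big => [|a _]; first exact: add_continuous.
by apply: cvg_big => [|b _]; first exact: add_continuous.
Qed.

(** The limit is taken coefficientwise. For fixed n each finite square sum of [u n - u m] passes to
    the limit in m and keeps the bound [e n], so the rate of convergence survives. *)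
Lemma H2_complete (u : nat -> family R) (e : nat -> R) : e @ \oo --> (0 : R) ->
  (forall n, H2 (u n)) -> (forall n m, (n <= m)%N -> nrm2 (u n - u m) <= e n) ->
  exists2 f, H2 f & forall n, nrm2 (u n - f) <= e n.
Proof.
move=> e0 uH ue.
have pt n m x : (n <= m)%N -> nsq (u n x - u m x) <= e n.
  by move=> nm; apply: le_trans (ue _ _ nm); apply: nsq_le_nrm2; exact: H2B.
have Rec x : cvgn (fun n => complex.Re (u n x)).
  apply: real_cauchy_cvg e0 _ => n m nm; apply: le_trans (pt n m x nm).
  by rewrite nsqB lerDl sqr_ge0.
have Imc x : cvgn (fun n => complex.Im (u n x)).
  apply: real_cauchy_cvg e0 _ => n m nm; apply: le_trans (pt n m x nm).
  by rewrite nsqB lerDr sqr_ge0.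
pose f : family R := fun x => Complex (limn (fun n => complex.Re (u n x)))
                         (limn (fun n => complex.Im (u n x))).
have key n : H2 (u n - f) /\ nrm2 (u n - f) <= e n.
  apply: sqs_nrm2_le => M.
  have cv : sqs M (fun x => nsq (u n x - u m x)) @[m --> \oo]
      --> sqs M (fun x => nsq ((u n - f) x)).
    apply: sqs_cvg => x.
    rewrite (_ : (fun _ => _) = (fun m => (complex.Re (u n x) - complex.Re (u m x)) ^+ 2 +
        (complex.Im (u n x) - complex.Im (u m x)) ^+ 2)); last first.
      by apply/funext => m; rewrite nsqB.
    rewrite (_ : nsq _ = (complex.Re (u n x) - complex.Re (f x)) ^+ 2 +
        (complex.Im (u n x) - complex.Im (f x)) ^+ 2); last first.
      exact: nsqB.
    apply: cvgD; rewrite expr2; under eq_fun do rewrite expr2.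
      by apply: cvgM; (apply: cvgB; [exact: cvg_cst|exact: Rec]).
    by apply: cvgM; (apply: cvgB; [exact: cvg_cst|exact: Imc]).
  rewrite -(cvg_lim (@Rhausdorff R) cv); apply: limr_le; first by apply/cvg_ex; eexists; exact: cv.
  exists n => // m /= nm; apply: le_trans (ue _ _ nm).
  by apply: sqs_le_nrm2; exact: H2B.
exists f; last by move=> n; have [] := key n.
by rewrite -[f](subKr (u 0%N)); apply: H2B => //; have [] := key 0%N.
Qed.

End Geometry.

Section Subspaces.
Variable R : realType.
Implicit Types (f g h : family R) (V L E : set (family R)).

Definition linspace L : Prop :=
  [/\ L `<=` H2 (R := R), L 0 & forall c f g, L f -> L g -> L (f + c *: g)].

(** The tolerance bounds the squared norm; as it is arbitrary, this is the usual closure in H^2. *)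
Definition clos L : set (family R) :=
  [set f | H2 f /\ forall eps : R, 0 < eps -> exists2 g, L g & nrm2 (f - g) < eps].

Definition closed_subspace V : Prop := linspace V /\ clos V `<=` V.

Lemma linspaceB L f g : linspace L -> L f -> L g -> L (f - g).
Proof. by move=> [_ _ lin] Lf Lg; rewrite -scaleN1r; exact: lin. Qed.

Lemma linspaceD L f g : linspace L -> L f -> L g -> L (f + g).
Proof. by move=> [_ _ lin] Lf Lg; rewrite -[g]scale1r; exact: lin. Qed.

Lemma linspaceZ L c f : linspace L -> L f -> L (c *: f).
Proof. by move=> [_ L0 lin] Lf; rewrite -[_ *: _]add0r; exact: lin. Qed.

Lemma sub_clos L : L `<=` H2 (R := R) -> L `<=` clos L.
Proof.
move=> LH f Lf; split; first exact: LH.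
by move=> eps e0; exists f => //; rewrite subrr nrm2_0.
Qed.

Lemma clos_closed L : linspace L -> closed_subspace (clos L).
Proof.
move=> [LH L0 lin]; split; [split|].
- by move=> f [].
- exact: sub_clos.
- move=> c f g [fH fL] [gH gL]; split=> [|eps e0].
    by apply: H2D => //; exact: H2Z.
  (* Dividing by 1 + |c|^2 rather than by |c|^2 covers c = 0. *)
  have n1 : 0 < 1 + nsq c by rewrite ltr_pwDl// nsq_ge0.
  have [f' Lf' ff'] := fL (eps / 4) ltac:(by rewrite divr_gt0).
  have [g' Lg' gg'] := gL (eps / 4 / (1 + nsq c)) ltac:(by rewrite !divr_gt0).
  exists (f' + c *: g'); first exact: lin.
  have f'H := H2B fH (LH _ Lf'); have g'H := H2B gH (LH _ Lg').
  rewrite (_ : _ - _ = (f - f') + c *: (g - g')); last first.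
    by rewrite scalerBr opprD addrACA.
  apply: le_lt_trans (nrm2D_le f'H (H2Z c g'H)) _; rewrite nrm2Z//.
  have : nsq c * nrm2 (g - g') <= eps / 4.
    apply: (@le_trans _ _ ((1 + nsq c) * nrm2 (g - g'))).
      by rewrite ler_wpM2r ?nrm2_ge0// lerDr.
    by rewrite mulrC -ler_pdivlMr// ltW.
  by move: ff'; lra.
- move=> f [fH fV]; split=> // eps e0.
  have [g [gH gL] fg] := fV (eps / 4) ltac:(by rewrite divr_gt0).
  have [h Lh gh] := gL (eps / 4) ltac:(by rewrite divr_gt0).
  exists h => //; rewrite -(subrKA g).
  apply: le_lt_trans (nrm2D_le (H2B fH gH) (H2B gH (LH _ Lh))) _.
  by move: fg gh; lra.
Qed.

Lemma small_eq0 (x K : R) : 0 <= x -> (forall n, x <= K * n.+1%:R^-1) -> x = 0.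
Proof.
move=> x0 xK; apply/eqP; rewrite eq_le x0 andbT.
have cv : (fun n => K * harmonic n) @ \oo --> (K * 0 : R).
  by apply: cvgM; [exact: cvg_cst|exact: cvg_harmonic].
rewrite -[leRHS](mulr0 K) -(cvg_lim (@Rhausdorff R) cv); apply: limr_ge.
  by apply/cvg_ex; exists (K * 0).
by apply: nearW => n; exact: xK.
Qed.

(** The parallelogram law makes a minimizing sequence Cauchy. Orthogonality is checked along the
    sequence: [nsq_inner_le] says that a near-minimizer is nearly orthogonal to V, and
    Cauchy-Schwarz controls the passage to the limit. *)
Theorem projection_exists V h : closed_subspace V -> H2 h ->
  exists2 g, V g & forall v, V v -> inner (h - g) v = 0.
Proof.
move=> [[VH V0 lin] Vc] hH.
pose D := [set nrm2 (h - g) | g in V]; pose d := inf D.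
have Dlb : has_lbound D by exists 0 => _ [g _ <-]; exact: nrm2_ge0.
have Dinf : has_inf D by split => //; exists (nrm2 (h - 0)), 0.
have dle g : V g -> d <= nrm2 (h - g) by move=> Vg; apply: ge_inf => //; exists g.
have : forall n : nat, exists g, V g /\ nrm2 (h - g) < d + n.+1%:R^-1.
  move=> n; have [] := @inf_adherent _ D (n.+1%:R^-1) _ Dinf; first by rewrite invr_gt0.
  by move=> _ [g Vg <-] lt; exists g.
move=> /choice[u uP]; have uV n : V (u n) by have [] := uP n.
have uH n : H2 (u n) by exact: VH.
have ud n : nrm2 (h - u n) < d + n.+1%:R^-1 by have [] := uP n.
have hu n : H2 (h - u n) by exact: H2B.
have dec n m : (n <= m)%N -> m.+1%:R^-1 <= n.+1%:R^-1 :> R.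
  by move=> nm; rewrite lef_pV2 ?posrE// ler_nat.
have cau n m : (n <= m)%N -> nrm2 (u n - u m) <= 4 * n.+1%:R^-1.
  move=> nm; rewrite (_ : u n - u m = (h - u m) - (h - u n)); last first.
    by rewrite opprB [RHS]addrC addrA subrK.
  rewrite parallelogram//.
  have : 4 * d <= nrm2 ((h - u m) + (h - u n)).
    rewrite (_ : _ + _ = 2 *: (h - 2^-1 *: (u m + u n))); last first.
      rewrite scalerBr scalerA divff ?pnatr_eq0// scale1r scaler_nat mulr2n.
      by rewrite opprD addrACA.
    rewrite nrm2Z; last by apply: H2B => //; apply: H2Z; exact: H2D.
    rewrite (_ : nsq 2 = 4); last by rewrite /nsq /=; ring.
    rewrite ler_pM2l//; apply: dle.
    rewrite -[_ *: _]add0r; apply: (lin) => //.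
    by rewrite -[u n]scale1r; exact: lin.
  by move: (ud n) (ud m) (dec _ _ nm); set x := n.+1%:R^-1; set y := m.+1%:R^-1; lra.
have e0 : (fun n => 4 * n.+1%:R^-1) @ \oo --> (0 : R).
  by rewrite -[X in _ --> X](mulr0 4); apply: cvgM; [exact: cvg_cst|exact: cvg_harmonic].
have [g gH ug] := H2_complete e0 uH cau.
exists g.
  apply: Vc; split=> // eps eps0.
  have /cvgrPdist_lt/(_ _ eps0)[N _ Ne] := e0.
  exists (u N) => //; rewrite nrm2C//; apply: le_lt_trans (ug N) _.
  have := Ne N (leqnn _); rewrite sub0r normrN; apply: le_lt_trans.
  exact: ler_norm.
move=> v Vv; have vH := VH _ Vv; apply/eqP; rewrite -nsq_eq0; apply/eqP.
(* With [nsqD_le] the two errors enter doubled: 2 * 1 from the near-minimizer and 2 * 4 from the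
   distance to the limit. *)
apply: (@small_eq0 _ (10 * nrm2 v)) => [|n]; first exact: nsq_ge0.
rewrite (_ : h - g = (h - u n) + (u n - g)); last by rewrite addrA subrK.
have ugH : H2 (u n - g) by exact: H2B.
rewrite innerDl//; apply: le_trans (nsqD_le _ _) _.
have i1 : nsq (inner (h - u n) v) <= n.+1%:R^-1 * nrm2 v.
  apply: (@le_trans _ _ ((nrm2 (h - u n) - d) * nrm2 v)).
    apply: nsq_inner_le => // c; rewrite -addrA -opprD; apply: dle.
    exact: lin.
  by rewrite ler_wpM2r ?nrm2_ge0//; move: (ud n); set x := n.+1%:R^-1; lra.
have i2 : nsq (inner (u n - g) v) <= 4 * n.+1%:R^-1 * nrm2 v.
  by apply: le_trans (cauchy_schwarz ugH vH) _; rewrite ler_wpM2r ?nrm2_ge0.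
by move: i1 i2; set K := _^-1; rewrite [10 * _ * K]mulrAC -[10 * K * _]mulrA; lra.
Qed.

Lemma projP V h : closed_subspace V -> H2 h ->
  V (Defs.proj V h) /\ forall v, V v -> inner (h - Defs.proj V h) v = 0.
Proof.
move=> cV hH; have [g Vg gP] := projection_exists cV hH.
by rewrite /Defs.proj; case: xgetP => [x _ []//|/(_ g)]; case.
Qed.

(** If S acts as an adjoint of T on all of H^2 as far as g is concerned, the adjoint on V is S
    followed by the projection onto V. The projection of [S g] shows that [xget] has a candidate,
    and any candidate differs from [S g] by a vector orthogonal to V. *)
Lemma adjP V T S g : closed_subspace V -> H2 (S g) ->
  (forall f, V f -> inner (T f) g = inner f (S g)) ->
  V (adj V T g) /\ forall v, V v -> inner (S g - adj V T g) v = 0.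
Proof.
move=> cV SgH TS; have VH := let: conj (And3 VH _ _) _ := cV in VH.
have [h Vh hP] := projection_exists cV SgH.
have orth f x : V f -> V x -> inner f (S g) = inner f x -> inner (S g - x) f = 0.
  move=> /VH fH /VH xH e; rewrite innerBl// (innerC fH)// (innerC fH xH) e subrr//.
have ex : V h /\ forall f, V f -> inner (T f) g = inner f h.
  split=> // f Vf; rewrite TS//; have fH := VH _ Vf; have hH := VH _ Vh.
  by apply/eqP; rewrite -subr_eq0 -innerBr// innerC ?hP ?conjC0//; exact: H2B.
rewrite /adj; case: xgetP => [x _ [Vx xP]|/(_ h)]; last by case.
by split=> // v Vv; apply: orth => //; rewrite -TS// xP.
Qed.

Lemma inner_eq0C f g : H2 f -> H2 g -> inner f g = 0 -> inner g f = 0.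
Proof. by move=> fH gH fg; rewrite innerC// fg conjC0. Qed.

Lemma Re_subC (a b : R) : complex.Re (Complex a 0 - b%:C%C) = a - b.
Proof. by []. Qed.

(** Zorn's lemma on orthonormal subsets of V. A nonzero vector orthogonal to a maximal one could be
    normalized and adjoined. *)
Lemma onb_exists V : closed_subspace V -> exists E, orthonormal_basis V E.
Proof.
move=> [[VH V0 lin] Vc].
pose P E := E `<=` V /\ forall e e', E e -> E e' -> inner e e' = (`[< e = e' >])%:R.
have [F FP Ftot|E [[EV Eon] Emax]] := @Zorn_bigcup _ P.
  split=> [e [X FX Xe]|e e' [X FX Xe] [Y FY Ye']]; first by have [+ _] := FP X FX; apply.
  have [XY|YX] := Ftot _ _ FX FY.
    by have [_] := FP _ FY; apply => //; exact: XY.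
  by have [_] := FP _ FX; apply => //; exact: YX.
exists E; split=> // f Vf fE; have fH := VH _ Vf; apply: contrapT => f0.
have nf : 0 < nrm2 f.
  by rewrite lt_neqAle nrm2_ge0 andbT eq_sym; apply/eqP => /(nrm2_eq0 fH).
pose e0 := Complex (Num.sqrt (nrm2 f))^-1 0 *: f.
have e0V : V e0 by rewrite -[e0]add0r; exact: lin.
have e0H := VH _ e0V.
have e01 : inner e0 e0 = 1.
  rewrite inner_self// nrm2Z// /nsq /= expr0n addr0 exprVn sqr_sqrtr ?(ltW nf)//.
  by rewrite mulVf ?gt_eqF.
have e0E e : E e -> inner e0 e = 0.
  by move=> Ee; rewrite innerZl ?fE ?mulr0//; apply: VH; exact: EV.
have nE0 : ~ E e0 by move=> /e0E/eqP; rewrite e01 oner_eq0.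
have ne e : E e -> (`[< e0 = e >])%:R = 0 :> R[i].
  by move=> Ee; case: asboolP => // e0e; rewrite -e0e in Ee.
apply: (Emax (E `|` [set e0])).
  split=> [e Ee|sub]; first by left.
  by apply: nE0; apply: sub; right.
split=> [e [/EV//|->//]|e e' [Ee|->] [Ee'|->]]; [exact: Eon| | |].
- rewrite inner_eq0C ?e0E//; last by apply: VH; exact: EV.
  by rewrite -(ne e Ee); congr (_%:R); apply: congr1; apply: asbool_equiv_eq; split.
- by rewrite e0E// ne.
- by rewrite e01; case: asboolP.
Qed.

Definition lincomb (s : seq (R[i] * family R)) : family R := \sum_(p <- s) p.1 *: p.2.

Lemma span_linspace E : E `<=` H2 (R := R) ->
  linspace [set f | exists2 s, (forall p, p \in s -> E p.2) & f = lincomb s].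
Proof.
move=> EH; split.
- move=> _ [s sE ->]; rewrite /lincomb big_seq; apply: H2_sum => p /sE/EH; exact: H2Z.
- by exists [::] => //; rewrite /lincomb big_nil.
- move=> c _ _ [s sE ->] [s' s'E ->].
  exists (s ++ [seq (c * p.1, p.2) | p <- s']).
    move=> p; rewrite mem_cat => /orP[/sE//|/mapP[q /s'E Eq ->]//].
  rewrite /lincomb big_cat big_map /=; congr (_ + _).
  by rewrite scaler_sumr; apply: eq_bigr => p _; rewrite scalerA.
Qed.

(** The residual identity for finite partial sums [s F] gives Bessel's inequality. For the converse,
    t is approximated by finite combinations of E, and no combination of vectors of F is closer to t
    than [s F]. *)
Theorem parseval V E t : closed_subspace V -> orthonormal_basis V E -> V t ->
  (\esum_(e in E) (nsq (inner t e))%:E = (nrm2 t)%:E)%E.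
Proof.
move=> cV [EV Eon Ec] Vt; have [[VH V0 lin] Vc] := cV.
have EH e : E e -> H2 e by move=> /EV/VH.
have tH := VH _ Vt.
pose s F := \sum_(e <- F) inner t e *: e.
have sH F : (forall e, e \in F -> E e) -> H2 (s F).
  by move=> FE; rewrite /s big_seq; apply: H2_sum => e /FE/EH; exact: H2Z.
have orthE F e : uniq F -> (forall e, e \in F -> E e) -> e \in F -> inner (t - s F) e = 0.
  move=> uF FE eF; have eH := EH _ (FE _ eF); have sFH := sH F FE.
  rewrite innerBl// {1}/s big_seq inner_suml//.
    rewrite -big_seq (bigD1_seq e)//= innerZl//.
    rewrite (Eon _ _ (FE _ eF) (FE _ eF)) asboolT// mulr1 big_seq_cond big1 ?addr0 ?subrr//.
    move=> e' /andP[e'F /eqP e'e].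
    rewrite innerZl//; last exact/EH/FE.
    by rewrite (Eon _ _ (FE _ e'F) (FE _ eF)) asboolF// mulr0.
  by move=> e' /FE/EH; exact: H2Z.
have orthS F : uniq F -> (forall e, e \in F -> E e) -> inner (t - s F) (s F) = 0.
  move=> uF FE; have sFH := sH F FE; have tsH := H2B tH sFH.
  apply: inner_eq0C => //.
  rewrite {1}/s big_seq inner_suml//; last by move=> e /FE/EH; exact: H2Z.
  rewrite big1// => e eF; rewrite innerZl//; last exact/EH/FE.
  by rewrite (inner_eq0C tsH (EH _ (FE _ eF)) (orthE _ _ uF FE eF)) mulr0.
have resid F : uniq F -> (forall e, e \in F -> E e) ->
    nrm2 (t - s F) = nrm2 t - \sum_(e <- F) nsq (inner t e).
  move=> uF FE; have sFH := sH F FE; have tsH := H2B tH sFH.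
  have os := orthS F uF FE.
  rewrite nrm2E// innerBr// os subr0 innerBl// inner_self//.
  rewrite {1}/s big_seq inner_suml//; last by move=> e /FE/EH; exact: H2Z.
  rewrite (eq_bigr (fun e => Complex (nsq (inner t e)) 0)); last first.
    move=> e /FE/EH eH; rewrite innerZl//.
    by rewrite (innerC tH eH) mul_conj_nsq.
  rewrite -big_seq -(rmorph_sum (real_complex R)).
  exact: Re_subC.
apply/eqP; rewrite eq_le; apply/andP; split.
  apply: ge_ereal_sup => _ [X [Xfin XE] <-].
  rewrite fsbig_finite//= sumEFin lee_fin.
  have := finmap.fset_uniq (fset_set X); set F := finmap.enum_fset _ => uF.
  have FE e : e \in F -> E e by rewrite in_fset_set// => /set_mem/XE.
  by have := resid F uF FE; have := nrm2_ge0 (t - s F); lra.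
(* t minus its projection on the closed span of E is orthogonal to E, so completeness of E forces it
   to be 0 and t lies in that span. *)
pose W := clos [set f | exists2 s, (forall p, p \in s -> E p.2) & f = lincomb s].
have cW : closed_subspace W by apply/clos_closed/span_linspace.
have WV : W `<=` V.
  move=> f [fH fW]; apply: Vc; split=> // eps /fW[_ [q qE ->] fq].
  exists (lincomb q) => //; rewrite /lincomb big_seq; have lV := cV.1.
  by apply: big_ind => // [x y|p /qE/EV]; [exact: linspaceD|exact: linspaceZ].
have [g Wg gP] := projection_exists cW tH.
have tg : t = g.
  apply/eqP; rewrite -subr_eq0; apply/eqP; apply: Ec.
    by apply: linspaceB => //; exact: WV.
  move=> e Ee; apply: gP; apply: sub_clos.
    by have [] := span_linspace EH.
  exists [:: (1, e)]; first by move=> p; rewrite inE => /eqP ->.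
  by rewrite /lincomb big_seq1 scale1r.
apply/lee_addgt0Pr => eps eps0.
have [_ tW] : W t by rewrite tg.
have [_ [q qE ->] tq] := tW _ eps0.
pose F := undup (map snd q).
have FE e : e \in F -> E e by rewrite mem_undup => /mapP[p /qE + ->].
have uF : uniq F by exact: undup_uniq.
have le : nrm2 t - \sum_(e <- F) nsq (inner t e) <= nrm2 (t - lincomb q).
  have sFH := sH F FE; have tsH := H2B tH sFH.
  have qH : H2 (lincomb q) by have [+ _ _] := span_linspace EH; apply; exists q.
  have sqH := H2B sFH qH.
  rewrite -resid// -[t - lincomb q](subrKA (s F)) (nrm2_pythagoras tsH sqH).
    by rewrite lerDl nrm2_ge0.
  rewrite innerBr//.
  rewrite orthS//.
  rewrite sub0r; apply/eqP; rewrite oppr_eq0; apply/eqP.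
  apply: inner_eq0C => //; rewrite /lincomb big_seq inner_suml//; last first.
    by move=> p /qE/EH; exact: H2Z.
  rewrite big1// => p pq; have pH := EH _ (qE _ pq); rewrite innerZl//.
  have pF : p.2 \in F by rewrite mem_undup; apply: map_f.
  by rewrite (inner_eq0C tsH pH (orthE _ _ uF FE pF)) mulr0.
apply: (@le_trans _ _ ((\sum_(e <- F) nsq (inner t e))%:E + eps%:E)%E).
  by rewrite -EFinD lee_fin; move: le tq; lra.
apply: leeD => //; apply: esum_ge; exists [set` F].
  by split; [exact: finite_seq|move=> e /= /FE].
by rewrite -fsbig_seq// sumEFin.
Qed.

End Subspaces.

(** * Shifts and principal submodules *)

Section Shifts.
Variable R : realType.
Implicit Types f g h : family R.

Definition swp f : family R := fun x => f (x.2, x.1).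
Definition shz f : family R := fun x => f (x.1.+1, x.2).
Definition shw f : family R := fun x => f (x.1, x.2.+1).

Lemma sqs_swap (V : nmodType) n (t : nat * nat -> V) : sqs n (fun x => t (x.2, x.1)) = sqs n t.
Proof. by rewrite /sqs exchange_big. Qed.

Lemma H2_swp f : H2 f -> H2 (swp f).
Proof.
move=> /H2P[B fB]; apply/H2P; exists B => n.
by rewrite (@sqs_swap _ n (fun x => nsq (f x))).
Qed.

Lemma inner_swp f g : inner (swp f) (swp g) = inner f g.
Proof.
have e n : sqs n (fun x => swp f x * Num.conj (swp g x)) =
    sqs n (fun x => f x * Num.conj (g x)).
  exact: (@sqs_swap _ n (fun x => f x * Num.conj (g x))).
pose lm (t : nat -> R[i]) := Complex (limn (fun n => complex.Re (t n)))
                                 (limn (fun n => complex.Im (t n))).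
exact: (congr1 lm (funext e)).
Qed.

Lemma nrm2_swp f : H2 f -> nrm2 (swp f) = nrm2 f.
Proof. by move=> fH; rewrite !nrm2E ?inner_swp//; exact: H2_swp. Qed.

Lemma mulwE f : mulw f = swp (mulz (swp f)).
Proof. by apply/funext => -[a [|b]]. Qed.

Lemma sqs_mulz_le f n : sqs n (fun x => nsq (mulz f x)) <= sqs n (fun x => nsq (f x)).
Proof.
case: n => [|n]; first by rewrite /sqs !big_ord0.
rewrite /sqs big_ord_recl big1 ?add0r => [|b _]; last by rewrite /mulz /= nsq0.
rewrite [leRHS]big_ord_recr lerDl sumr_ge0// => b _; exact: nsq_ge0.
Qed.

Lemma H2_mulz f : H2 f -> H2 (mulz f) /\ nrm2 (mulz f) <= nrm2 f.
Proof.
move=> fH; apply: sqs_nrm2_le => n; apply: le_trans (sqs_mulz_le f n) _.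
exact: sqs_le_nrm2.
Qed.

Lemma H2_mulw f : H2 f -> H2 (mulw f) /\ nrm2 (mulw f) <= nrm2 f.
Proof.
move=> fH; have sH := H2_swp fH; have [mH mle] := H2_mulz sH.
by rewrite mulwE nrm2_swp// -(nrm2_swp fH); split=> //; exact: H2_swp.
Qed.

Lemma H2_shz f : H2 f -> H2 (shz f) /\ nrm2 (shz f) <= nrm2 f.
Proof.
move=> fH; apply: sqs_nrm2_le => n; apply: le_trans (sqs_le_nrm2 n.+1 fH).
rewrite /sqs [leRHS]big_ord_recl ler_wpDl ?sumr_ge0// => [b _|]; first exact: nsq_ge0.
by apply: ler_sum => a _; rewrite [leRHS]big_ord_recr lerDl nsq_ge0.
Qed.

Lemma H2_shw f : H2 f -> H2 (shw f) /\ nrm2 (shw f) <= nrm2 f.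
Proof.
move=> fH; have sH := H2_swp fH; have [mH mle] := H2_shz sH.
by rewrite (nrm2_swp mH : nrm2 (shw f) = _) -(nrm2_swp fH); split=> //; exact: (H2_swp mH).
Qed.

(** L f equals L of the tail f - [tr n] of f outside a square, and the squared norm of the tail
    tends to 0. A negative K is possible only if all norms vanish, which the proof treats apart. *)
Lemma dense_ext (L : family R -> R[i]) K :
  (forall f g, H2 f -> H2 g -> L (f - g) = L f - L g) ->
  (forall f, H2 f -> nsq (L f) <= K * nrm2 f) ->
  (forall f n, (forall x, ~~ ((x.1 < n)%N && (x.2 < n)%N) -> f x = 0) -> L f = 0) ->
  forall f, H2 f -> L f = 0.
Proof.
move=> LB LK Lfin f fH; apply/eqP; rewrite -nsq_eq0; apply/eqP.
pose tr n : family R := fun x => if (x.1 < n)%N && (x.2 < n)%N then f x else 0.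
have tr0 n x : ~~ ((x.1 < n)%N && (x.2 < n)%N) -> tr n x = 0 by rewrite /tr => /negbTE->.
have trH n : H2 (tr n) by apply: H2_fin (tr0 n).
have rest n : nrm2 (f - tr n) <= nrm2 f - sqs n (fun x => nsq (f x)).
  suff [] : H2 (f - tr n) /\ nrm2 (f - tr n) <= nrm2 f - sqs n (fun x => nsq (f x)) by [].
  apply: sqs_nrm2_le => m; rewrite lerBrDr.
  apply: le_trans (sqs_le_nrm2 (maxn m n) fH).
  rewrite (@sqs_widen _ n (maxn m n))// ?leq_maxr//.
  apply: (@le_trans _ _ (sqs (maxn m n) (fun x => nsq ((f - tr n) x)) +
     sqs (maxn m n) (fun x => if (x.1 < n)%N && (x.2 < n)%N then nsq (f x) else 0))).
    by rewrite lerD2r; apply: sqs_mono; rewrite ?leq_maxl// => x; exact: nsq_ge0.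
  rewrite -sqsD; apply: le_sqs => x.
  rewrite -[(f - tr n) x]/(f x - tr n x) /tr; case: ifP => _.
    by rewrite subrr nsq0 add0r.
  by rewrite subr0 addr0.
have le n : nsq (L f) <= K * (nrm2 f - sqs n (fun x => nsq (f x))).
  have -> : L f = L (f - tr n) by rewrite LB// (Lfin (tr n) n (tr0 n)) subr0.
  apply: le_trans (LK _ (H2B fH (trH n))) _.
  have [K0|K0] := leP 0 K; first by rewrite ler_wpM2l.
  have z g : H2 g -> nrm2 g = 0.
    move=> gH; apply/eqP; rewrite eq_le nrm2_ge0 andbT leNgt; apply/negP => g0.
    have := le_trans (nsq_ge0 _) (LK g gH); rewrite leNgt => /negP; apply.
    by rewrite nmulr_rlt0.
  have fn : 0 <= nrm2 f - sqs n (fun x => nsq (f x)) by rewrite subr_ge0 sqs_le_nrm2.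
  have := fn; rewrite z// sub0r => fn'; rewrite z ?mulr0; last exact: H2B.
  have s0 : sqs n (fun x => nsq (f x)) = 0.
    apply/eqP; rewrite eq_le -oppr_ge0 fn' sqs_ge0// => x; exact: nsq_ge0.
  by rewrite s0 oppr0 mulr0.
have cv : (fun n => K * (nrm2 f - sqs n (fun x => nsq (f x)))) @ \oo --> K * (nrm2 f - nrm2 f).
  by apply: cvgM; [exact: cvg_cst|apply: cvgB; [exact: cvg_cst|exact: nrm2_cvg]].
apply/eqP; rewrite eq_le nsq_ge0 andbT -[leRHS](mulr0 K) -(subrr (nrm2 f)).
rewrite -(cvg_lim (@Rhausdorff R) cv); apply: limr_ge; first by apply/cvg_ex; eexists; exact: cv.
by apply: nearW => n; exact: le.
Qed.

Lemma mulzB f g : mulz (f - g) = mulz f - mulz g.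
Proof. by apply/funext => -[[|a] b]//; rewrite -[LHS]/(0) -[RHS]/(0 - 0) subrr. Qed.

Lemma mulwB f g : mulw (f - g) = mulw f - mulw g.
Proof. by rewrite !mulwE -[RHS]/(swp (mulz (swp f) - mulz (swp g))) -mulzB. Qed.

Lemma inner_mulz f g : H2 f -> H2 g -> inner (mulz f) g = inner f (shz g).
Proof.
move=> fH gH; apply/eqP; rewrite -subr_eq0; apply/eqP.
have [sgH sgle] := H2_shz gH.
(* Each of the two terms has squared modulus at most |f|^2 |g|^2, and [nsqD_le] doubles both: hence
   the bound 4 |g|^2. *)
move: f fH; apply: (@dense_ext (fun f => inner (mulz f) g - inner f (shz g)) (4 * nrm2 g)).
- move=> f h fH hH; rewrite mulzB !innerBl//; first by ring.
    by have [] := H2_mulz fH.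
  by have [] := H2_mulz hH.
- move=> f fH; have [mH mle] := H2_mulz fH; apply: le_trans (nsqD_le _ _) _; rewrite nsqN.
  have := cauchy_schwarz mH gH; have := cauchy_schwarz fH sgH.
  have : nrm2 (mulz f) * nrm2 g <= nrm2 f * nrm2 g by rewrite ler_wpM2r ?nrm2_ge0.
  have : nrm2 f * nrm2 (shz g) <= nrm2 f * nrm2 g by rewrite ler_wpM2l ?nrm2_ge0.
  by lra.
- move=> f n f0; rewrite (@inner_fin _ _ _ n.+1); last first.
    move=> [[|a] b] /=; first by rewrite /mulz mul0r.
    rewrite ltnS => h; rewrite /mulz /= f0 ?mul0r//=; apply: contra h => /andP[-> bn] /=.
    exact: ltnW.
  rewrite (@inner_fin _ _ _ n.+1); last first.
    move=> [a b] /= h; rewrite f0 ?mul0r//=; apply: contra h => /andP[an bn].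
    by rewrite !leqW.
  rewrite /sqs big_ord_recl big1 ?add0r => [|b _]; last by rewrite /mulz /= mul0r.
  rewrite [X in _ - X]big_ord_recr [X in _ - (_ + X)]big1 ?addr0 ?subrr// => b _.
  by rewrite f0 ?mul0r//= ltnn.
Qed.

Lemma inner_mulw f g : H2 f -> H2 g -> inner (mulw f) g = inner f (shw g).
Proof.
move=> fH gH; rewrite mulwE -(inner_swp _ g) -[swp (swp _)]/(mulz (swp f)).
by rewrite inner_mulz; [rewrite -(inner_swp f)| exact: H2_swp|exact: H2_swp].
Qed.

End Shifts.

Section Submodule.
Variable R : realType.
Implicit Types (f g h u : family R) (p q : {poly {poly R[i]}}).

Lemma coefsB (p q : {poly {poly R[i]}}) : coefs (p - q) = coefs p - coefs q.
Proof. by apply/funext => -[a b]; rewrite /coefs !coefB. Qed.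

Lemma coefsD (p q : {poly {poly R[i]}}) : coefs (p + q) = coefs p + coefs q.
Proof. by apply/funext => -[a b]; rewrite /coefs !coefD. Qed.

Lemma coefsZ c (p : {poly {poly R[i]}}) : coefs (c%:P%:P * p) = c *: coefs p.
Proof. by apply/funext => -[a b]; rewrite /coefs !coefCM. Qed.

Lemma coefs0 : coefs (0 : {poly {poly R[i]}}) = 0.
Proof. by apply/funext => -[a b]; rewrite /coefs !coef0. Qed.

Lemma H2_coefs (p : {poly {poly R[i]}}) : H2 (coefs p).
Proof.
pose n := maxn (size p) (\max_(b < size p) size (p`_b)%R).
apply: (@H2_fin _ _ n) => -[a b] /= ; rewrite /coefs /= negb_and -!leqNgt.
move=> /orP[na|nb]; last by rewrite [p`_b]nth_default ?coef0// (leq_trans _ nb)// leq_maxl.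
have [bp|pb] := ltnP b (size p); last by rewrite [p`_b]nth_default ?coef0.
rewrite nth_default// (leq_trans _ na)// (leq_trans _ (leq_maxr _ _))//.
exact: (@leq_bigmax _ (fun b : 'I_(size p) => size (p`_b)%R) (Ordinal bp)).
Qed.

Lemma mulw_coefs (p : {poly {poly R[i]}}) : mulw (coefs p) = coefs (p * wvar R).
Proof. by apply/funext => -[a [|b]]; rewrite /coefs /wvar coefMX //= coef0. Qed.

Definition multiples (p : {poly {poly R[i]}}) : set (family R) :=
  [set f | exists q, f = coefs (p * q)].

Lemma multiples_linspace p : linspace (multiples p).
Proof.
split; first by move=> _ [q ->]; exact: H2_coefs.
  by exists 0; rewrite mulr0 coefs0.
move=> c _ _ [q ->] [q' ->]; exists (q + c%:P%:P * q').
by rewrite mulrDr coefsD mulrCA coefsZ.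
Qed.

Lemma submoduleE p : submodule p = clos (multiples p).
Proof.
apply/seteqP; split => f [fH fP]; split=> // eps e0.
  have [q] := fP (Num.sqrt eps) ltac:(by rewrite sqrtr_gt0); rewrite /hnorm -/(nrm2 _).
  by rewrite ltr_sqrt// => lt; exists (coefs (p * q)) => //; exists q.
have [_ [q ->] lt] := fP (eps ^+ 2) ltac:(by rewrite exprn_gt0).
exists q; rewrite /hnorm -/(nrm2 _) -[ltRHS]gtr0_norm// -sqrtr_sqr ltr_sqrt//.
by rewrite exprn_gt0.
Qed.

Lemma submodule_closed p : closed_subspace (submodule p).
Proof. by rewrite submoduleE; apply/clos_closed/multiples_linspace. Qed.

Lemma submodule_H2 p f : submodule p f -> H2 f.
Proof. by case. Qed.

Lemma multiples_sub p q : submodule p (coefs (p * q)).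
Proof.
rewrite submoduleE; apply: sub_clos; last by exists q.
by have [] := multiples_linspace p.
Qed.

(** Subtracting the vanishing product with a nearby multiple of p and applying Cauchy-Schwarz makes
    the product with f arbitrarily small. *)
Lemma submodule_orth p u : H2 u -> (forall q, inner (coefs (p * q)) u = 0) ->
  forall f, submodule p f -> inner f u = 0.
Proof.
move=> uH pu f; rewrite submoduleE => -[fH fP].
apply/eqP; rewrite -nsq_eq0; apply/eqP.
apply: (@small_eq0 R _ (nrm2 u)) => [|n]; first exact: nsq_ge0.
have [_ [q ->] lt] := fP (n.+1%:R^-1) ltac:(by rewrite invr_gt0).
have qH := H2_coefs (p * q); have fqH := H2B fH qH.
rewrite -[inner f u]subr0 -(pu q) -innerBl//.
apply: le_trans (cauchy_schwarz fqH uH) _.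
by rewrite mulrC ler_wpM2l ?nrm2_ge0// ltW.
Qed.

Lemma submodule_mulw p f : submodule p f -> submodule p (mulw f).
Proof.
rewrite submoduleE => -[fH fP]; split=> [|eps e0]; first by have [] := H2_mulw fH.
have [_ [q ->] lt] := fP eps e0.
exists (mulw (coefs (p * q))).
  by exists (q * wvar R); rewrite mulw_coefs mulrA.
rewrite -mulwB; apply: le_lt_trans lt.
by have [] := H2_mulw (H2B fH (H2_coefs (p * q))).
Qed.

Lemma adj_mulz p g : submodule p g -> submodule p (adj (submodule p) (@mulz R) g) /\
  forall v, submodule p v -> inner (shz g - adj (submodule p) (@mulz R) g) v = 0.
Proof.
move=> Mg; have gH := submodule_H2 Mg; apply: adjP; first exact: submodule_closed.
  by have [] := H2_shz gH.
by move=> f /submodule_H2 fH; exact: inner_mulz.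
Qed.

Lemma adj_mulw p g : submodule p g -> submodule p (adj (submodule p) (@mulw R) g) /\
  forall v, submodule p v -> inner (shw g - adj (submodule p) (@mulw R) g) v = 0.
Proof.
move=> Mg; have gH := submodule_H2 Mg; apply: adjP; first exact: submodule_closed.
  by have [] := H2_shw gH.
by move=> f /submodule_H2 fH; exact: inner_mulw.
Qed.

End Submodule.

(** * The submodule generated by z^k - w^k *)

Section PowerDifference.
Variables (R : realType) (k : nat).
Hypothesis k_gt0 : (0 < k)%N.
Implicit Types (f g h u : family R) (q : {poly {poly R[i]}}).

Local Notation M := (submodule (Mpoly R k)).
Local Notation R1 := (adj M (@mulz R)).
Local Notation R2 := (adj M (@mulw R)).

Lemma coefs_Mpoly q a b : coefs (Mpoly R k * q) (a, b) =
  (if (k <= a)%N then coefs q (a - k, b)%N else 0) -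
  (if (k <= b)%N then coefs q (a, b - k)%N else 0).
Proof.
rewrite /Mpoly mulrBl coefsB /zvar /wvar -polyC_exp /coefs.
rewrite -[LHS]/((('X^k)%:P * q)`_b`_a - ('X^k * q)`_b`_a) /=.
rewrite coefCM !coefXnM ltnNge; congr (_ - _); first by case: leqP.
by rewrite ltnNge; case: leqP => //; rewrite coef0.
Qed.

Lemma coefs_monomial a b : coefs (zvar R ^+ a * wvar R ^+ b) = dlt R (a, b).
Proof.
apply/funext => -[c d]; rewrite /coefs /zvar /wvar -polyC_exp /= coefCM coefXn /dlt xpair_eqE.
have [_|_] := eqVneq d b; last by rewrite mulr0 coef0 andbF.
by rewrite mulr1 coefXn andbT.
Qed.

Lemma coefs_Mpoly_monomial a b :
  coefs (Mpoly R k * (zvar R ^+ a * wvar R ^+ b)) = dlt R (a + k, b)%N - dlt R (a, b + k)%N.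
Proof.
rewrite /Mpoly mulrBl coefsB mulrA -exprD coefs_monomial (addnC k).
by rewrite mulrCA -exprD coefs_monomial (addnC k).
Qed.

(** For r, s < k this runs over the m-th antidiagonal of the exponents congruent to (r, s) mod k,
    which has m + 1 points. *)
Definition cls r s m f : R[i] := \sum_(i < m.+1) f (r + k * i, s + k * (m - i))%N.

(** Multiplication by z^k and by w^k moves the (m-1)-st antidiagonal of the class onto the m-th, up
    to one end point each; at these end points nothing arrives because r, s < k. *)
Lemma cls_Mpoly r s m q : (r < k)%N -> (s < k)%N -> cls r s m (coefs (Mpoly R k * q)) = 0.
Proof.
move=> rk sk; rewrite /cls; under eq_bigr do rewrite coefs_Mpoly.
rewrite sumrB big_ord_recl [X in _ - X]big_ord_recr /=.
rewrite muln0 addn0 leqNgt rk /= subnn muln0 addn0 leqNgt sk /= add0r addr0.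
apply/eqP; rewrite subr_eq0; apply/eqP; apply: eq_bigr => i _; rewrite /bump /= add1n.
have im := ltn_ord i.
by rewrite !ifT; first (congr coefs; congr (_, _)); nia.
Qed.

Lemma cls_inner r s m f : cls r s m f =
  \sum_(i < m.+1) inner f (dlt R (r + k * i, s + k * (m - i))%N).
Proof. by apply: eq_bigr => i _; rewrite inner_dlt. Qed.

(** [cls] is the inner product with a finitely supported vector, so its vanishing passes from the
    multiples of z^k - w^k to their closure. *)
Lemma cls_eq0 r s m f : (r < k)%N -> (s < k)%N -> M f -> cls r s m f = 0.
Proof.
move=> rk sk; pose u := \sum_(i < m.+1) dlt R (r + k * i, s + k * (m - i))%N.
have uH : H2 u by apply: H2_sum => i _; exact: H2_dlt.
have clsE g : H2 g -> inner g u = cls r s m g.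
  move=> gH; rewrite innerC// inner_suml//; last by move=> i _; exact: H2_dlt.
  rewrite rmorph_sum cls_inner; apply: eq_bigr => i _ /=.
  by rewrite -innerC//; exact: H2_dlt.
move=> Mf; rewrite -clsE; last exact: submodule_H2 Mf.
apply: submodule_orth Mf => // q.
by rewrite clsE ?cls_Mpoly//; exact: H2_coefs.
Qed.

Lemma orth_shift u a b : H2 u -> (forall v, M v -> inner u v = 0) ->
  u (a + k, b)%N = u (a, b + k)%N.
Proof.
move=> uH uM; have := uM _ (multiples_sub (Mpoly R k) (zvar R ^+ a * wvar R ^+ b)).
rewrite coefs_Mpoly_monomial innerBr//; [|exact: H2_dlt|exact: H2_dlt].
by rewrite !inner_dlt => /eqP; rewrite subr_eq0 => /eqP.
Qed.

(* A vector orthogonal to [M] is constant on the antidiagonals of each residue class, and on these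
   the vectors of [M] sum to 0: the projection subtracts the mean. *)
Lemma proj_coef h g r s i l : H2 h -> M g -> (forall v, M v -> inner (h - g) v = 0) ->
  (r < k)%N -> (s < k)%N ->
  g (r + k * i, s + k * l)%N =
  h (r + k * i, s + k * l)%N - cls r s (i + l) h / (i + l).+1%:R.
Proof.
move=> hH Mg hgM rk sk; have gH := submodule_H2 Mg; set u := h - g in hgM.
have uH : H2 u by exact: H2B.
set m := (i + l)%N.
have ui j : (j <= m)%N -> u (r + k * j, s + k * (m - j))%N = u (r, s + k * m)%N.
  elim: j => [_|j IH jm]; first by rewrite muln0 addn0 subn0.
  rewrite -IH; last exact: ltnW.
  have -> : (r + k * j.+1 = r + k * j + k)%N by rewrite mulnS addnCA addnC.
  rewrite orth_shift//; congr (u (_, _)).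
  by rewrite -addnA -mulnSr; congr (_ + k * _)%N; rewrite -subSn.
have uc : cls r s m h = m.+1%:R * u (r, s + k * m)%N.
  rewrite -[LHS]subr0 -(cls_eq0 m rk sk Mg) /cls -sumrB.
  rewrite (eq_bigr (fun=> u (r, s + k * m)%N)); last first.
    by move=> j _; rewrite -(ui j)// -ltnS.
  by rewrite sumr_const card_ord mulr_natl.
rewrite uc mulrAC divff ?mul1r ?pnatr_eq0// -(ui i) ?leq_addr//.
by rewrite /m addKn /u -[X in _ - X]/(h _ - g _) subKr.
Qed.

(** R_1^* g is the projection of the backward shift of g, which on the class (r, s) shows the class
    (r + 1, s) of g. If r + 1 < k that class is complete, its mean is 0 and nothing is subtracted.
    If r = k - 1 the entry of g at z-exponent 0 is missing, the rest sums to minus that entry, and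
    subtracting the mean adds the fraction displayed, whose denominator counts the points of the
    antidiagonal. *)
Lemma adj_mulz_coef g a b : M g -> R1 g (a, b) = g (a.+1, b) +
  (if (k %| a.+1)%N then g (0, a.+1 + b)%N / (a.+1 %/ k + b %/ k)%:R else 0).
Proof.
move=> Mg; have gH := submodule_H2 Mg; have [M1 orth] := adj_mulz Mg.
have [sH _] := H2_shz gH.
have rk := ltn_pmod a k_gt0; have sk := ltn_pmod b k_gt0.
have ea : (a = a %% k + k * (a %/ k))%N by rewrite addnC mulnC -divn_eq.
have eb : (b = b %% k + k * (b %/ k))%N by rewrite addnC mulnC -divn_eq.
move: ea eb rk sk; set r := (a %% k)%N; set i := (a %/ k)%N; set s := (b %% k)%N.
set l := (b %/ k)%N => ea eb rk sk.
rewrite {1}ea {1}eb (proj_coef _ _ sH M1 orth rk sk) -ea -eb -[shz g (a, b)]/(g (a.+1, b)).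
congr (_ + _); case: ifP => [ka|nka].
  have rE : r = k.-1.
    have : (k %| r.+1)%N.
      by move: ka; rewrite ea -addSn (dvdn_addl _ (dvdn_mulr _ (dvdnn k))).
    by move=> /(dvdn_leq (ltn0Sn _)) kr; lia.
  have -> : (a.+1 %/ k = i.+1)%N.
    by rewrite ea -addSn rE prednK// -mulnS mulKn.
  rewrite addSn; set K := _^-1; rewrite -mulNr; congr (_ * _).
  have := cls_eq0 (i + l).+1 k_gt0 sk Mg.
  rewrite /cls big_ord_recl /= muln0 addn0 subn0.
  have -> : (s + k * (i + l).+1 = a.+1 + b)%N.
    by rewrite ea eb rE; move: k_gt0; clear; nia.
  move=> /eqP; rewrite addr_eq0 => /eqP ->; congr (- _).
  apply: eq_bigr => j _; rewrite /shz /= /bump /= add1n subSS; congr (g (_, _)).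
  by rewrite rE -addSn prednK// add0n -mulnS.
rewrite (_ : cls _ _ _ _ = 0) ?mul0r ?oppr0//.
have rk1 : (r.+1 < k)%N.
  rewrite ltn_neqAle rk andbT; apply: contraFneq nka => rE.
  by rewrite ea -addSn rE -mulnS dvdn_mulr.
by rewrite -(cls_eq0 (i + l) rk1 sk Mg); apply: eq_bigr.
Qed.

(** As for [adj_mulz_coef], with the entry at w-exponent 0 missing, which is the last one in [cls]
    instead of the first. *)
Lemma adj_mulw_coef g a b : M g -> R2 g (a, b) = g (a, b.+1) +
  (if (k %| b.+1)%N then g (a + b.+1, 0)%N / (a %/ k + b.+1 %/ k)%:R else 0).
Proof.
move=> Mg; have gH := submodule_H2 Mg; have [M1 orth] := adj_mulw Mg.
have [sH _] := H2_shw gH.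
have rk := ltn_pmod a k_gt0; have sk := ltn_pmod b k_gt0.
have ea : (a = a %% k + k * (a %/ k))%N by rewrite addnC mulnC -divn_eq.
have eb : (b = b %% k + k * (b %/ k))%N by rewrite addnC mulnC -divn_eq.
move: ea eb rk sk; set r := (a %% k)%N; set i := (a %/ k)%N; set s := (b %% k)%N.
set l := (b %/ k)%N => ea eb rk sk.
rewrite {1}ea {1}eb (proj_coef _ _ sH M1 orth rk sk) -ea -eb -[shw g (a, b)]/(g (a, b.+1)).
congr (_ + _); case: ifP => [kb|nkb].
  have sE : s = k.-1.
    have : (k %| s.+1)%N.
      by move: kb; rewrite eb -addSn (dvdn_addl _ (dvdn_mulr _ (dvdnn k))).
    by move=> /(dvdn_leq (ltn0Sn _)) ks; lia.
  have -> : (b.+1 %/ k = l.+1)%N.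
    by rewrite eb -addSn sE prednK// -mulnS mulKn.
  rewrite !addnS; set K := _^-1; rewrite -mulNr; congr (_ * _).
  have := cls_eq0 (i + l).+1 rk k_gt0 Mg.
  rewrite /cls big_ord_recr /= subnn muln0 addn0.
  have -> : (r + k * (i + l).+1 = (a + b).+1)%N.
    by rewrite ea eb sE; move: k_gt0; clear; nia.
  rewrite addrC => /eqP; rewrite addr_eq0 => /eqP ->; congr (- _).
  apply: eq_bigr => j _; rewrite /shw /=; congr (g (_, _)).
  by rewrite sE -addSn prednK// add0n -mulnS subSn// -ltnS.
rewrite (_ : cls _ _ _ _ = 0) ?mul0r ?oppr0//.
have sk1 : (s.+1 < k)%N.
  rewrite ltn_neqAle sk andbT; apply: contraFneq nkb => sE.
  by rewrite eb -addSn sE -mulnS dvdn_mulr.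
by rewrite -(cls_eq0 (i + l) rk sk1 Mg); apply: eq_bigr => j _; rewrite /shw /= addSn.
Qed.

End PowerDifference.

(** * The core operator *)

Section CoreOperator.
Variable R : realType.
Implicit Types (f g h : family R).

Definition meanfree h : family R := fun x =>
  h x - (\sum_(j < (x.1 + x.2).+1) h (val j, x.1 + x.2 - j)%N) / (x.1 + x.2).+1%:R.

(** On H^2 this is the core operator for k = 1, with [meanfree] the projection onto [z - w]. Away
    from the axes the value is (g(0, n) + g(n, 0)) / (n (n - 1)); it is left in the form in which
    the formulas for R_1^* and R_2^* produce it. *)
Definition core_model h : family R := fun x =>
  let g := meanfree h in
  match x with
  | (0, 0)%N => g (0, 0)%N
  | (i, 0)%N => - (g (0, i)%N / i%:R)
  | (0, l)%N => - (g (l, 0)%N / l%:R)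
  | (i, l'.+1) => let n := (i + l'.+1)%N in
      (g (0, n)%N + g (n, 0)%N / n%:R) / (i + l')%:R - g (0, n)%N / n%:R
  end.

Section Lattice.
Variable k : nat.
Hypothesis k_gt0 : (0 < k)%N.
Local Notation M := (submodule (Mpoly R k)).
Local Notation R1 := (adj M (@mulz R)).
Local Notation R2 := (adj M (@mulw R)).

Definition contract f : family R := fun x => f (k * x.1, k * x.2)%N.

Definition dilate h : family R := fun x =>
  if (k %| x.1)%N && (k %| x.2)%N then h (x.1 %/ k, x.2 %/ k)%N else 0.

Lemma dilateK h : contract (dilate h) = h.
Proof. by apply/funext => -[a b]; rewrite /contract /dilate /= !dvdn_mulr// !mulKn. Qed.

Lemma scale_inj : injective (fun x : nat * nat => (k * x.1, k * x.2)%N).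
Proof.
move=> [a b] [c d] [/eqP + /eqP]; rewrite !eqn_pmul2l//.
by move=> /eqP -> /eqP ->.
Qed.

Lemma hnorm2_lattice f : (\esum_(x in [set (k * x.1, k * x.2)%N | x in [set: nat * nat]])
  (nsq (f x))%:E = hnorm2 (contract f))%E.
Proof. by rewrite hnorm2_nsq esum_image// => x y _ _; exact: scale_inj. Qed.

Lemma H2_contract f : H2 f -> H2 (contract f).
Proof.
rewrite /H2 /= -hnorm2_lattice; apply: le_lt_trans.
rewrite hnorm2_nsq esum_mkcond; apply: le_esum => x _.
by case: ifP => _ //; rewrite lee_fin nsq_ge0.
Qed.

Lemma H2_dilate h : H2 h -> H2 (dilate h).
Proof.
rewrite /H2 /= -{1}(dilateK h) -hnorm2_lattice; apply: le_lt_trans.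
rewrite hnorm2_nsq [leRHS]esum_mkcond; apply: le_esum => -[a b] _.
case: ifPn => // /negP nx; rewrite /dilate /=; case: ifP => [/andP[ka kb]|_]; last by rewrite nsq0.
exfalso; apply: nx; rewrite inE; exists (a %/ k, b %/ k)%N => //=.
by rewrite ![(k * _)%N]mulnC !divnK.
Qed.

Lemma proj_lattice f i l : H2 f ->
  Defs.proj M f (k * i, k * l)%N = meanfree (contract f) (i, l).
Proof.
move=> fH; have [Mg orth] := projP (submodule_closed (Mpoly R k)) fH.
have := proj_coef k_gt0 i l fH Mg orth k_gt0 k_gt0; rewrite !add0n => ->.
by rewrite /meanfree /contract /=; congr (_ - _ / _).
Qed.

(** Inserting the formulas for R_1^* and R_2^* cancels the values of g and of R_2^* g at the point
    itself; only axis corrections remain. Off the axes these need k | a. If k does not divide b,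
    then b and b - 1 have the same quotient by k and the two corrections cancel as well. *)
Lemma core_coef f a b : H2 f -> core M f (a, b) =
  if (k %| a)%N && (k %| b)%N then core_model (contract f) (a %/ k, b %/ k)%N else 0.
Proof.
move=> fH; have [Mg _] := projP (submodule_closed (Mpoly R k)) fH.
pose g := Defs.proj M f; rewrite -/g in Mg.
have [M2 _] := adj_mulw Mg.
have gE i l : g (k * i, k * l)%N = meanfree (contract f) (i, l) by exact: proj_lattice.
have gE0 l : g (0, k * l)%N = meanfree (contract f) (0, l)%N by rewrite -gE muln0.
have g0E i : g (k * i, 0)%N = meanfree (contract f) (i, 0)%N by rewrite -gE muln0.
rewrite -[LHS]/(g (a, b) - mulz (R1 g) (a, b) - mulw (R2 g) (a, b) +
  mulz (mulw (R1 (R2 g))) (a, b)).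
case: a b => [|a] [|b].
- rewrite !dvdn0 !div0n /= /mulz /mulw /= -(gE 0 0)%N !muln0.
  by rewrite !subr0 addr0.
- rewrite dvdn0 /= /mulz /mulw /= subr0 addr0 (adj_mulw_coef k_gt0)// add0n div0n add0n.
  rewrite opprD addrA subrr add0r; case: ifP => [/dvdnP[l bE]|_]; last by rewrite oppr0.
  rewrite bE mulnK// mulnC g0E; case: l bE => // bE; by rewrite mul0n in bE.
- rewrite dvdn0 andbT /= /mulz /mulw /= subr0 addr0 (adj_mulz_coef k_gt0)// addn0 div0n addn0.
  rewrite opprD addrA subrr add0r; case: ifP => [/dvdnP[i aE]|_]; last by rewrite oppr0.
  rewrite aE mulnK// mulnC gE0; case: i aE => // aE; by rewrite mul0n in aE.
- rewrite /mulz /mulw /= !(adj_mulz_coef k_gt0)// (adj_mulw_coef k_gt0 a.+1 b)//.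
  case: ifP => [ka|_] /=; last by ring.
  rewrite (adj_mulw_coef k_gt0 0 _)// div0n !add0n.
  have -> : (a.+1 + b).+1 = (a.+1 + b.+1)%N by rewrite addnS.
  rewrite (dvdn_addr _ ka); case: ifP => [kb|nkb]; last first.
    have -> : (b.+1 %/ k = b %/ k)%N by rewrite divnS// nkb.
    by rewrite ?nkb addr0; ring.
  have [[//|i] aE] := dvdnP ka; have [[//|l] bE] := dvdnP kb.
  have -> : (b %/ k = l)%N.
    have -> : b = (k.-1 + k * l)%N by nia.
    by rewrite mulnC addnC divnMDl// divn_small ?addn0//; lia.
  rewrite ?kb.
  rewrite aE bE -mulnDl !mulnK// ![(_ * k)%N]mulnC gE0 g0E.
  by rewrite /core_model; ring.
Qed.

End Lattice.

Lemma has_dim_iso (V W : set (family R)) (A B : family R -> family R) d :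
  linear A -> linear B -> (forall f, V f -> W (A f) /\ B (A f) = f) ->
  (forall h, W h -> V (B h) /\ A (B h) = h) -> has_dim V d -> has_dim W d.
Proof.
move=> linA linB AV BW [e [eV eP]].
have A0 : A 0 = 0 by have := linA (-1) 0 0; rewrite scaler0 add0r scaleN1r addrC subrr.
have B0 : B 0 = 0 by have := linB (-1) 0 0; rewrite scaler0 add0r scaleN1r addrC subrr.
have AD f g : A (f + g) = A f + A g by have := linA 1 f g; rewrite !scale1r.
have BD f g : B (f + g) = B f + B g by have := linB 1 f g; rewrite !scale1r.
have AZ c f : A (c *: f) = c *: A f by have := linA c f 0; rewrite A0 !addr0.
have BZ c f : B (c *: f) = c *: B f by have := linB c f 0; rewrite B0 !addr0.
have AS (c : 'I_d -> R[i]) (F : 'I_d -> family R) :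
    A (\sum_i c i *: F i) = \sum_i c i *: A (F i).
  by rewrite (big_morph A AD A0); apply: eq_bigr.
have BS (c : 'I_d -> R[i]) (F : 'I_d -> family R) :
    B (\sum_i c i *: F i) = \sum_i c i *: B (F i).
  by rewrite (big_morph B BD B0); apply: eq_bigr.
exists (A \o e); split=> [i|h Wh]; first by have [] := AV _ (eV i).
have [VB ABh] := BW _ Wh; have [c [cE cU]] := eP _ VB.
exists c; split=> [|c' hE]; first by rewrite -ABh cE AS.
apply: cU; rewrite hE BS; apply: eq_bigr => i _ /=.
by have [_ ->] := AV _ (eV i).
Qed.

(** Off the lattice of multiples of k the core operator gives 0, so an eigenvector with lam <> 0
    vanishes there; hence [contract] and [dilate] are mutually inverse between the two
    eigenspaces. *)
Lemma has_dim_core k lam d : (0 < k)%N -> lam <> 0 ->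
  has_dim (eigenspace_H2 (core (submodule (Mpoly R k))) lam) d <->
  has_dim (eigenspace_H2 core_model lam) d.
Proof.
move=> k_gt0 lam0.
have lin_c : linear (contract k) by move=> c f g; apply/funext.
have lin_d : linear (dilate k).
  move=> c f g; apply/funext => x.
  rewrite -[RHS]/(c * dilate k f x + dilate k g x) /dilate.
  by case: ifP => _ //; rewrite mulr0 addr0.
have cV f : eigenspace_H2 (core (submodule (Mpoly R k))) lam f ->
    eigenspace_H2 core_model lam (contract k f) /\ dilate k (contract k f) = f.
  move=> [fH fE]; split.
    split; first exact: H2_contract.
    apply/funext => -[i l]; have := congr1 (fun h => h (k * i, k * l)%N) fE.
    by rewrite core_coef// !dvdn_mulr// !mulKn.
  apply/funext => -[a b]; rewrite /dilate /contract /=.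
  case: ifPn => [/andP[ka kb]|nk]; first by rewrite ![(k * _)%N]mulnC !divnK.
  have := congr1 (fun h => h (a, b)) fE; rewrite core_coef// (negbTE nk).
  by move=> /esym/eqP; rewrite -[(lam *: f) (a, b)]/(lam * f (a, b)) mulf_eq0 => /orP[/eqP//|/eqP].
have dV h : eigenspace_H2 core_model lam h ->
    eigenspace_H2 (core (submodule (Mpoly R k))) lam (dilate k h) /\
    contract k (dilate k h) = h.
  move=> [hH hE]; split; last exact: dilateK.
  split; first exact: H2_dilate.
  apply/funext => -[a b]; rewrite core_coef//; last exact: H2_dilate.
  rewrite dilateK// hE -[RHS]/(lam * dilate k h (a, b)) /dilate /=.
  by case: ifP => _ //; rewrite mulr0.
split; [exact: (has_dim_iso lin_c lin_d cV dV)|exact: (has_dim_iso lin_d lin_c dV cV)].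
Qed.

End CoreOperator.

(** * The first invariant *)

Section HilbertSchmidt.
Variable R : realType.
Implicit Types (f g h e : family R).

Lemma nsq_real (c : R) : nsq (c%:C%C) = c ^+ 2.
Proof. by rewrite /nsq /= expr0n addr0. Qed.

Lemma esum_swap (T1 T2 : choiceType) (I : set T1) (J : set T2) (a : T1 -> T2 -> \bar R) :
  (forall i j, (0 <= a i j)%E) ->
  (\esum_(i in I) \esum_(j in J) a i j = \esum_(j in J) \esum_(i in I) a i j)%E.
Proof.
move=> a0; rewrite !esum_esum//.
rewrite (reindex_esum (J `*`` fun=> I) _ (fun x => (x.2, x.1)))//; split.
- by move=> [i j] [/=].
- by move=> [i1 i2] [j1 j2] /= _ _ [] -> ->.
- by move=> [i1 i2] [Pi1 Qi2] /=; exists (i2, i1).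
Qed.

(** Evaluation at x is the inner product with a monomial, hence on the submodule with the projection
    t of that monomial. Parseval is applied to a multiple of t, and |t|^2 = <t, t> is the
    coefficient of t at x. *)
Lemma esum_onb_eval p (E : set (family R)) x : orthonormal_basis (submodule p) E ->
  exists2 t, submodule p t &
    (forall v, submodule p v -> inner (dlt R x - t) v = 0) /\
    forall c : R[i], (\esum_(e in E) (nsq (c * e x))%:E = (nsq c * complex.Re (t x))%:E)%E.
Proof.
move=> onbE; have cM := submodule_closed p.
have [Mt orth] := projP cM (H2_dlt R x); set t := Defs.proj _ _ in Mt orth.
have tH := submodule_H2 Mt; have dH := H2_dlt R x.
exists t => //; split=> // c.
have et v : submodule p v -> inner t v = Num.conj (v x).
  move=> Mv; have vH := submodule_H2 Mv; apply/eqP; rewrite eq_sym -subr_eq0.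
  by rewrite -(inner_dlt v x) -innerC// -innerBl// orth.
have Mct : submodule p (Num.conj c *: t) by have [lM _] := cM; exact: linspaceZ.
have := parseval cM onbE Mct; rewrite nrm2Z// nrm2E// et//.
rewrite nsqJ (_ : complex.Re (Num.conj _) = complex.Re (t x)); last by rewrite conjE.
move=> <-; apply: eq_esum => e Ee; have [EM _ _] := onbE.
have Me := EM _ Ee; rewrite innerZl//; last exact: submodule_H2 Me.
by rewrite et// -rmorphM nsqJ.
Qed.

Lemma esum_antidiagonal (a : nat * nat -> \bar R) : (forall x, (0 <= a x)%E) ->
  (\esum_(x in [set: nat * nat]) a x =
   \esum_(n in [set: nat]) \sum_(l < n.+1) a (n - l, val l)%N)%E.
Proof.
move=> a0; transitivity (\esum_(n in [set: nat]) \esum_(l in `I_n.+1) a (n - l, l)%N)%E.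
  rewrite esum_esum// [RHS](reindex_esum [set: nat * nat] _ (fun x => (x.1 + x.2, x.2)%N)).
    by apply: eq_esum => -[i l] _ /=; rewrite addnK.
  split=> [[i l] _|[i l] [i' l'] _ _ /= [ii ll]|[n l] /= [_ ln]] /=.
  - by split=> //=; rewrite ltnS leq_addl.
  - by move: ii; rewrite ll => /eqP; rewrite eqn_add2r => /eqP ->.
  - by exists (n - l, l)%N => //=; rewrite subnK.
apply: eq_esum => n _; by rewrite esum_fset// -fsbig_ord.
Qed.

Variable k : nat.
Hypothesis k_gt0 : (0 < k)%N.
Local Notation M := (submodule (Mpoly R k)).
Local Notation R1 := (adj M (@mulz R)).

(** The two reciprocals are the correction factors of R_1^* after and before multiplication by w; at
    w-exponent 0 the second is absent because w R_1^* g has no coefficient there. *)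
Definition cross_weight (x : nat * nat) : R :=
  if (k %| x.1.+1)%N then
    (x.1.+1 %/ k + x.2 %/ k)%:R^-1 -
    (if x.2 is b.+1 then (x.1.+1 %/ k + b %/ k)%:R^-1 else 0)
  else 0.

Lemma cross_comm_coef g x : M g ->
  comm R1 (@mulw R) g x = (cross_weight x)%:C%C * g (0, x.1 + x.2)%N.
Proof.
move=> Mg; have Mwg := submodule_mulw Mg; case: x => a b.
have natC n : (n%:R : R)^-1%:C%C = n%:R^-1 :> R[i].
  by rewrite (fmorphV (real_complex R)) rmorph_nat.
rewrite -[LHS]/(R1 (mulw g) (a, b) - mulw (R1 g) (a, b)) (adj_mulz_coef k_gt0)//.
rewrite /cross_weight /mulw /=; case: b => [|b] /=.
  rewrite subr0 add0r div0n; case: ifP => _; last by rewrite ?subr0 mul0r.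
  by rewrite !addn0 ?subr0 natC mulrC.
rewrite (adj_mulz_coef k_gt0)// addSnnS; case: ifP => _; last by rewrite mul0r !addr0 subrr.
rewrite (rmorphB (real_complex R)) /= !natC -addSnnS.
by rewrite addSn; ring.
Qed.

Lemma cross_comm_H2 g : M g -> H2 (comm R1 (@mulw R) g).
Proof.
move=> Mg; have [M1 _] := adj_mulz Mg; have [M1' _] := adj_mulz (submodule_mulw Mg).
by apply: H2B; [exact: submodule_H2 M1'|have [] := H2_mulw (submodule_H2 M1)].
Qed.

Lemma hs2_cross_comm : hs2 M (comm R1 (@mulw R)) =
  (\esum_(n in [set: nat]) (n.+2%:R ^- 2)%:E)%E.
Proof.
have [E0 onb0] := onb_exists (submodule_closed (Mpoly R k)).
rewrite /hs2; have : orthonormal_basis M (xget set0 [set E | orthonormal_basis M E]).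
  by case: xgetP => // /(_ E0).
set E := xget _ _ => onbE; have [EM _ _] := onbE.
transitivity (\esum_(e in E) \esum_(x in [set: nat * nat])
    (nsq ((cross_weight x)%:C%C * e (0, x.1 + x.2)%N))%:E)%E.
  apply: eq_esum => e /EM Me; have TH := cross_comm_H2 Me.
  rewrite /hnorm sqr_sqrtr; last exact: nrm2_ge0.
  rewrite -[fine _]/(nrm2 _) -hnorm2E// hnorm2_nsq.
  by apply: eq_esum => x _; rewrite cross_comm_coef.
(* With the sum over the basis innermost, each coefficient becomes a case of [esum_onb_eval]. *)
rewrite esum_swap; last by move=> *; rewrite lee_fin nsq_ge0.
pose tau (x : nat * nat) : R := let N := (x.1 + x.2).+1%:R in
  (if x.2 == 0%N then N ^- 2 else (N^-1 - (x.1 + x.2)%:R^-1) ^+ 2) * (1 - N^-1).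
have tau0 x : 0 <= tau x.
  rewrite mulr_ge0//; last by rewrite subr_ge0 invf_le1// ler1n.
  by case: ifP => _; rewrite ?sqr_ge0// invr_ge0 exprn_ge0.
(* These are the only exponents with nonzero weight: k | a + 1 is built into [cross_weight], and if
   k does not divide b the two reciprocals coincide. *)
pose lift (x : nat * nat) := (k * x.1 + k.-1, k * x.2)%N.
have lift_inj : injective lift.
  move=> [a b] [c d] [/eqP + /eqP]; rewrite eqn_add2r !eqn_pmul2l//.
  by move=> /eqP -> /eqP ->.
have liftS x : (lift x).1.+1 = (k * x.1.+1)%N by rewrite /lift /= mulnS; lia.
transitivity (\esum_(x in [set: nat * nat]) (tau x)%:E)%E.
  transitivity (\esum_(x in [set lift x | x in [set: nat * nat]])
      (\esum_(e in E) (nsq ((cross_weight x)%:C%C * e (0, x.1 + x.2)%N))%:E))%E.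
    rewrite [RHS]esum_mkcond; apply: eq_esum => -[a b] _; case: ifPn => // /negP nx.
    apply: esum1 => e _; rewrite (_ : cross_weight _ = 0); last first.
      rewrite /cross_weight /=; case: ifP => // /dvdnP[[|i] aE]; first by rewrite mul0n in aE.
      have nb : ~~ (k %| b)%N.
        apply/negP => /dvdnP[l bE]; apply: nx; rewrite inE; exists (i, l) => //.
        by rewrite /lift /= bE mulnC; congr (_, _); rewrite mulnC//; nia.
      case: b nb {nx} => [|b nb]; first by rewrite dvdn0.
      by rewrite (divnS b k_gt0) (negbTE nb) add0n subrr.
    by rewrite mul0r nsq0.
  rewrite esum_image; last by move=> x y _ _; exact: lift_inj.
  apply: eq_esum => -[i l] _.
  have [t Mt [orth ->]] := esum_onb_eval (0, (lift (i, l)).1 + (lift (i, l)).2)%N onbE.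
  rewrite nsq_real; congr (_%:E).
  (* The monomial w^(kN-1), N = i + l + 1, lies in the class (0, k - 1) on an antidiagonal of N
     points, so subtracting the mean leaves 1 - 1/N. *)
  have -> : t (0, (lift (i, l)).1 + (lift (i, l)).2)%N = 1 - (i + l).+1%:R^-1.
    have km1 : (k.-1 < k)%N by rewrite prednK.
    have -> : (0, (lift (i, l)).1 + (lift (i, l)).2)%N =
        (0 + k * 0, k.-1 + k * (i + l))%N by rewrite /lift /=; congr (_, _); nia.
    rewrite (proj_coef k_gt0 0 (i + l) (H2_dlt R _) Mt orth k_gt0 km1) add0n.
    rewrite /cls big_ord_recl /= subn0 big1 => [|j _]; last first.
      rewrite /dlt xpair_eqE; case: eqP => //= /eqP.
      by rewrite add0n muln_eq0 /bump /= eqn0Ngt k_gt0.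
    have dltE x y : x = y -> dlt R x y = 1 by move=> ->; rewrite /dlt eqxx.
    rewrite addr0 !dltE ?mul1r//=; congr (_, _); nia.
  have -> : complex.Re (1 - (i + l).+1%:R^-1 : R[i]) = 1 - (i + l).+1%:R^-1.
    have -> : (i + l).+1%:R^-1 = ((i + l).+1%:R^-1 : R)%:C%C.
      by rewrite (fmorphV (real_complex R)) rmorph_nat.
    exact: (@Re_subC R 1).
  rewrite /tau /=; congr (_ * _).
  rewrite /cross_weight liftS dvdn_mulr// mulKn//= mulKn//.
  clear t Mt orth; case: l => [|l] /=; first by rewrite muln0 !addn0 subr0 exprVn.
  rewrite addSn; case E1 : (k * l.+1)%N => [|b]; first by nia.
  have -> : (b %/ k = l)%N.
    have -> : b = (l * k + k.-1)%N by nia.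
    by rewrite divnMDl// divn_small ?addn0// prednK.
  by rewrite addSnnS.
rewrite esum_antidiagonal => [|x]; last by rewrite lee_fin.
(* On the n-th antidiagonal put N = n + 1. For n > 0 the squared weights add up to 1/N^2 + n (1/n -
   1/N)^2 = 1/(N n), and the factor 1 - 1/N = n/N turns this into 1/N^2. For n = 0 that factor is 0,
   whence the shift of index to m = n - 1. *)
pose F n : R := if n is m.+1 then m.+2%:R ^- 2 else 0.
transitivity (\esum_(n in [set: nat]) (F n)%:E)%E.
  apply: eq_esum => n _; rewrite sumEFin; congr (_%:E).
  rewrite big_ord_recl /tau /= subn0 addn0.
  under eq_bigr => l _.
    rewrite /bump /= add1n subnK//; over.
  rewrite sumr_const card_ord /F; case: n => [|n].
    by rewrite invr1 subrr !mulr0 mulr0n addr0.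
  rewrite -[X in _ + X]mulr_natl; field.
  by rewrite nat1r -natrD !pnatr_eq0.
transitivity (\esum_(n in [set m.+1 | m in [set: nat]]) (F n)%:E)%E.
  rewrite [RHS]esum_mkcond; apply: eq_esum => -[|n] _; first by case: ifP.
  by rewrite ifT// inE; exists n.
by rewrite esum_image// => x y _ _ [].
Qed.

End HilbertSchmidt.

(** * The Gram matrix *)

Section GramMatrix.
Variables (R : realType) (k : nat).
Hypothesis k_gt0 : (0 < k)%N.
Local Notation p := (Mpoly R k).

Definition gvec (n l : nat) : family R := dlt R (l + k, n - l)%N - dlt R (l, n - l + k)%N.

Lemma gvecE n l : coefs (p * zvar R ^+ l * wvar R ^+ (n - l)) = gvec n l.
Proof. by rewrite -mulrA coefs_Mpoly_monomial. Qed.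

Lemma H2_gvec n l : H2 (gvec n l).
Proof. by apply: H2B; exact: H2_dlt. Qed.

(** The vectors p z^l w^(n-l) are differences of two monomials, and two of them share a monomial
    only at distance k. So the matrix splits into second-difference matrices with zero boundary
    values, one per residue class mod k. *)
Lemma gramE n (i l : 'I_n.+1) : gram p n i l =
  2 * (i == l :> nat)%:R - (i == l + k :> nat)%N%:R - (l == i + k :> nat)%N%:R.
Proof.
have [il ll] := (ltn_ord i, ltn_ord l).
rewrite mxE !gvecE innerBr; [|exact: H2_dlt|exact: H2_dlt|exact: H2_gvec].
rewrite !inner_dlt -![gvec _ _ _]/(dlt R _ _ - dlt R _ _) /dlt !xpair_eqE.
have -> : ((i + k == l + k) && (n - i == n - l) = (i == l :> nat))%N by lia.
have -> : ((i + k == l) && (n - i == n - l + k) = (l == i + k :> nat))%N by lia.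
have -> : ((i == l + k :> nat) && (n - i + k == n - l) = (i == l + k :> nat))%N by lia.
have -> : ((i == l :> nat) && (n - i + k == n - l + k) = (i == l :> nat))%N by lia.
by ring.
Qed.

(* Up to the factor [m + 2] this is the first column of the inverse of [gram p n]. *)
Definition gsol (n l : nat) : R[i] := if (k %| l)%N then ((n %/ k).+1 - l %/ k)%:R else 0.

Lemma gsol_big n l : (n < l)%N -> gsol n l = 0.
Proof.
move=> nl; rewrite /gsol; case: ifP => // /dvdnP[t lE]; rewrite lE mulnK//.
rewrite (_ : _ - _ = 0)%N//; apply/eqP; rewrite subn_eq0 -ltnS.
by rewrite ltnS ltn_divLR// -lE.
Qed.

Lemma sum_pick n j (F : nat -> R[i]) :
  \sum_(l < n) (j == l :> nat)%:R * F l = if (j < n)%N then F j else 0.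
Proof.
case: ifPn => [jn|nj].
  rewrite (bigD1 (Ordinal jn))//= eqxx mul1r big1 ?addr0// => i /eqP ij.
  by case: eqP => [jE|_]; [case: ij; apply: val_inj|rewrite mul0r].
rewrite big1// => i _; case: eqP => [jE|_]; last by rewrite mul0r.
by rewrite jE ltn_ord in nj.
Qed.

(** On the multiples of k [gsol] is linear, so its second differences vanish inside. At the far end
    it reaches 0 exactly one step beyond the last multiple of k up to n, as the boundary condition
    demands. At 0 the missing neighbour leaves 2 (m + 1) - m = m + 2, with m = n / k. *)
Lemma gram_gsol n (i : 'I_n.+1) :
  \sum_(l < n.+1) gram p n i l * gsol n l = if i == ord0 then (n %/ k).+2%:R else 0.
Proof.
have iln := ltn_ord i.
transitivity (2 * gsol n i - (if (k <= i)%N then gsol n (i - k) else 0) - gsol n (i + k)).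
  under eq_bigr do rewrite gramE !mulrBl -mulrA.
  rewrite !sumrB -mulr_sumr sum_pick iln; congr (_ - _ - _).
    case: ifPn => [ki|nki].
      transitivity (\sum_(l < n.+1) (i - k == l :> nat)%N%:R * gsol n l).
        by apply: eq_bigr => l _; congr (_%:R * _); congr nat_of_bool; lia.
      by rewrite sum_pick ifT//; lia.
    by rewrite big1// => l _; rewrite (_ : _ == _ = false) ?mul0r//; lia.
  transitivity (\sum_(l < n.+1) (i + k == l :> nat)%N%:R * gsol n l).
    by apply: eq_bigr => l _; rewrite eq_sym.
  by rewrite sum_pick; case: ifPn => // nik; rewrite gsol_big//; lia.
have -> : (i == ord0) = (i == 0 :> nat)%N by [].
have [i0|i0] := eqVneq (val i) 0%N.
  rewrite i0 leqn0 (gtn_eqF k_gt0) add0n /gsol dvdn0 dvdnn div0n divnn k_gt0 !subSS !subn0 subr0.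
  by ring.
case: (boolP (k %| i)%N) => [ki|nki]; last first.
  rewrite /gsol (negbTE nki) (dvdn_addl _ (dvdnn k)) (negbTE nki) subr0 mulr0 sub0r.
  case: ifPn => [ki|_]; last by rewrite oppr0.
  by rewrite -(dvdn_addl (i - k) (dvdnn k)) subnK// (negbTE nki) oppr0.
have [[|t] iE] := dvdnP ki; first by move: i0; rewrite /= iE.
have tm : (t.+1 <= n %/ k)%N by rewrite leq_divRL// -iE.
have kt : (k <= i)%N by rewrite iE mulSn leq_addr.
have -> : (i - k = t * k)%N by rewrite iE mulSn addKn.
have -> : (i + k = t.+2 * k)%N by rewrite iE [RHS]mulSn addnC.
rewrite kt iE /gsol !dvdn_mull// !mulnK// !subSS (natrB _ tm) (natrB _ (ltnW tm)) -natr1.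
have -> : ((n %/ k).+1 - t)%:R = (n %/ k)%:R + 1 - t%:R :> R[i].
  by rewrite natrB ?natr1//; apply: leqW; exact: ltnW.
by ring.
Qed.

(** The matrix is invariant under reversing both indices. *)
Lemma gram_gsol_rev n (i : 'I_n.+1) :
  \sum_(l < n.+1) gram p n i l * gsol n (n - l) =
  if i == ord_max then (n %/ k).+2%:R else 0.
Proof.
rewrite (reindex_inj rev_ord_inj) /=.
transitivity (\sum_(l < n.+1) gram p n (rev_ord i) l * gsol n l).
  apply: eq_bigr => l _; have ll := ltn_ord l; have il := ltn_ord i.
  rewrite !gramE /= !subSS subKn; last by rewrite -ltnS.
  have -> : (i == n - l :> nat)%N = (n - i == l)%N by lia.
  have -> : (i == n - l + k :> nat)%N = (l == n - i + k :> nat)%N by lia.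
  have -> : (n - l == i + k)%N = (n - i == l + k)%N by lia.
  by congr (_ * _); rewrite addrAC.
rewrite gram_gsol; congr (if _ then _ else _).
by rewrite -[RHS](inj_eq rev_ord_inj); congr (_ == _); apply: val_inj => /=; rewrite subnn.
Qed.

(** Cramer's rule by the adjugate. No invertibility is assumed, so it can also serve to compute the
    determinants themselves. *)
Lemma cofactor_solve n (A : 'M[R[i]]_n.+1) (x : nat -> R[i]) (t : R[i]) i0 :
  (forall i, \sum_(l < n.+1) A i l * x l = if i == i0 then t else 0) ->
  forall l : 'I_n.+1, \det A * x l = t * cofactor A i0 l.
Proof.
move=> Ax l; pose X : 'cV[R[i]]_n.+1 := \col_l x l.
have AX : A *m X = t *: delta_mx i0 0.
  apply/colP => i; rewrite !mxE; under eq_bigr do rewrite mxE.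
  by rewrite Ax eqxx andbT; case: eqP => _; rewrite ?mulr1 ?mulr0.
have := congr1 (fun Y => (\adj A *m Y) l 0) AX.
rewrite mulmxA mul_adj_mx -scalemx1 -scalemxAl mul1mx -scalemxAr -colE !mxE.
by [].
Qed.

(** By the Toeplitz form, deleting the first or the last row and column of A^n leaves A^(n-1). *)
Lemma gramdet_cofactor n : cofactor (gram p n) ord0 ord0 = gramdet p n /\
  cofactor (gram p n) ord_max ord_max = gramdet p n.
Proof.
case: n => [|n].
  by rewrite /cofactor /= !det_mx00 !mulr1 !addn0 !expr0.
rewrite /cofactor /= addn0 expr0 addnn -signr_odd odd_double expr0 !mul1r.
split; congr (\det _); apply/matrixP => i j; rewrite 2![in LHS]mxE !gramE /=.
  by rewrite /bump !leq0n !add1n !addSn !eqSS.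
have bumpE (l : 'I_n.+1) : bump n.+1 l = l by rewrite /bump leqNgt ltn_ord.
by rewrite !bumpE.
Qed.

End GramMatrix.

(** * The higher invariants *)

Section HigherInvariants.
Variables (R : realType) (k : nat).
Hypothesis k_gt0 : (0 < k)%N.
Local Notation p := (Mpoly R k).

(** An unnormalized phi_n. With m = n / k it has m + 1 entries equal to 1 and one equal to -(m + 1),
    so its entries sum to 0 and its squared norm is (m + 1)(m + 2). *)
Definition top (n : nat) : family R := fun x =>
  if (x.1 + x.2 == n + k)%N && (k %| x.1)%N then
    (if x.1 == 0%N then - (n %/ k).+1%:R else 1)
  else 0.

(** Each coefficient is a difference of two consecutive values of a linear function, hence 1; at
    z-exponent 0 there is no preceding value and -[gsol] at 0 remains. *)
Lemma sum_gsol n : \sum_(l < n.+1) gsol R k n l *: gvec R k n l = top n.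
Proof.
apply/funext => -[a b]; rewrite fct_sumE /top /=.
under eq_bigr => l _ do rewrite -[(_ *: _) _]/(_ * (dlt R _ _ - dlt R _ _)) /dlt !xpair_eqE.
have [abE|abN] /= := eqVneq (a + b)%N (n + k)%N; last first.
  rewrite big1// => l _; have ll := ltn_ord l.
  have -> : ((a == l + k) && (b == n - l))%N = false by lia.
  have -> : ((a == l) && (b == n - l + k))%N = false by lia.
  by rewrite subrr mulr0.
have -> : \sum_(l < n.+1) gsol R k n l * (((a == l + k) && (b == n - l))%N%:R -
      ((a == l) && (b == n - l + k))%N%:R) =
    (if (k <= a)%N then gsol R k n (a - k) else 0) - gsol R k n a.
  under eq_bigr do rewrite mulrBr.
  rewrite sumrB; congr (_ - _).
    case: ifPn => ka; last first.
      rewrite big1// => l _; have -> : ((a == l + k) && (b == n - l))%N = false by lia.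
      by rewrite mulr0.
    transitivity (\sum_(l < n.+1) (a - k == l :> nat)%N%:R * gsol R k n l).
      apply: eq_bigr => l _; rewrite mulrC; congr (_%:R * _); congr nat_of_bool.
      by have ll := ltn_ord l; lia.
    by rewrite sum_pick ifT//; lia.
  transitivity (\sum_(l < n.+1) (a == l :> nat)%N%:R * gsol R k n l).
    apply: eq_bigr => l _; rewrite mulrC; congr (_%:R * _); congr nat_of_bool.
    by have ll := ltn_ord l; lia.
  by rewrite sum_pick; case: ifPn => // an; rewrite gsol_big//; lia.
case: (boolP (k %| a)%N) => [ka|nka]; last first.
  rewrite /gsol (negbTE nka) subr0; case: ifPn => // kla.
  by rewrite -(dvdn_addl (a - k) (dvdnn k)) subnK// (negbTE nka).
have [[|t] aE] := dvdnP ka.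
  by rewrite aE mul0n leqn0 (gtn_eqF k_gt0) /gsol dvdn0 div0n subn0 sub0r.
have kla : (k <= a)%N by rewrite aE mulSn leq_addr.
have -> : (a - k = t * k)%N by rewrite aE mulSn addKn.
rewrite kla /gsol aE !dvdn_mull// !mulnK// muln_eq0 (gtn_eqF k_gt0) /= subSS.
have tn : (t <= n %/ k)%N.
  by rewrite leq_divRL// -(leq_add2r k) -mulSnr -aE -abE leq_addr.
by rewrite subSn// -natr1 addrAC subrr add0r.
Qed.

(** Exchanging z and w reverses the index l and changes z^k - w^k into its negative. *)
Lemma sum_gsol_rev n :
  \sum_(l < n.+1) gsol R k n (n - l) *: gvec R k n l = - swp (top n).
Proof.
rewrite -sum_gsol [LHS](reindex_inj rev_ord_inj) /=; apply/funext => -[a b].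
rewrite fct_sumE -[RHS]/(- (\sum_(l < n.+1) gsol R k n l *: gvec R k n l) (b, a)).
rewrite fct_sumE -sumrN.
apply: eq_bigr => l _; have ll := ltn_ord l.
rewrite !subSS subKn; last by rewrite -ltnS.
rewrite -[LHS]/(_ * (dlt R _ _ - dlt R _ _)) -[RHS]/(- (_ * (dlt R _ _ - dlt R _ _))).
rewrite -mulrN opprB /dlt !xpair_eqE subKn; last by rewrite -ltnS.
by congr (_ * (_%:R - _%:R)); rewrite andbC.
Qed.

(** This is Cramer's rule read at the entry l = 0, where the cofactor is the preceding
    determinant. *)
Lemma gramdet_rec n : gramdet p n.+1 * (n %/ k).+1%:R = (n %/ k).+2%:R * gramdet p n.
Proof.
have := cofactor_solve (@gram_gsol R k k_gt0 n) ord0.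
by have [-> _] := gramdet_cofactor R k_gt0 n; rewrite /gsol dvdn0 div0n subn0.
Qed.

Lemma gramdet_pos n : exists2 d : R, 0 < d & gramdet p n = d%:C%C.
Proof.
elim: n => [|n [d d0 dE]]; first by exists 1.
exists ((n %/ k).+2%:R * d / (n %/ k).+1%:R); first by rewrite divr_gt0// mulr_gt0.
apply: (mulIf (x := (n %/ k).+1%:R)); first by rewrite pnatr_eq0.
rewrite gramdet_rec dE -!(rmorph_nat (real_complex R)) -!(rmorphM (real_complex R)) /=.
by rewrite divfK// pnatr_eq0.
Qed.

(** With m = n / k, the scalar is c = D_(n+1) / ((m + 2) sqrt(D_n D_(n+1))), the same for both
    vectors, and [gramdet_rec] evaluates |c|^2. The result is the inverse of the squared norm of
    [top n]. *)
Lemma phi_psi n : exists2 c : R[i],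
  nsq c = ((n %/ k).+1%:R * (n %/ k).+2%:R)^-1 &
  phi p n = c *: top n /\ psi p n = c *: - swp (top n).
Proof.
set m := (n %/ k)%N; have m2 : m.+2%:R != 0 :> R[i] by rewrite pnatr_eq0.
have cofE i0 (x : nat -> R[i]) (s : family R) :
    (forall i, \sum_(l < n.+1) gram p n i l * x l = if i == i0 then m.+2%:R else 0) ->
    \sum_(l < n.+1) x l *: gvec R k n l = s ->
    \sum_(l < n.+1) cofactor (gram p n) i0 l *: coefs (p * zvar R ^+ l * wvar R ^+ (n - l)) =
    (gramdet p n.+1 / m.+2%:R) *: s.
  move=> gx <-; rewrite scaler_sumr; apply: eq_bigr => l _; rewrite gvecE scalerA.
  congr (_ *: _); apply: (mulfI m2); rewrite -(cofactor_solve gx).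
  by rewrite mulrA [_ * (_ / _)]mulrC divfK.
exists ((sqrtC (gramdet p n * gramdet p n.+1))^-1 * (gramdet p n.+1 / m.+2%:R)); last first.
  rewrite /phi /psi -!scalerA; split; congr (_ *: _); rewrite scalerA.
    exact: (cofE _ (gsol R k n) _ (@gram_gsol R k k_gt0 n) (sum_gsol n)).
  exact: (cofE _ (fun l => gsol R k n (n - l)%N) _
    (@gram_gsol_rev R k k_gt0 n) (sum_gsol_rev n)).
have [d d0 dE] := gramdet_pos n; have [d' d'0 d'E] := gramdet_pos n.+1.
have rec : d' * m.+1%:R = m.+2%:R * d.
  have := gramdet_rec n; rewrite dE d'E -!(rmorph_nat (real_complex R)).
  by rewrite -!(rmorphM (real_complex R)) => /complexI.
have sq : nsq (sqrtC (gramdet p n * gramdet p n.+1)) = d * d'.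
  have dd : 0 <= d * d' by rewrite mulr_ge0 ?ltW.
  apply/eqP; rewrite -(@eqrXn2 _ 2)// ?nsq_ge0// expr2 -nsqM -expr2 sqrtCK dE d'E.
  by rewrite -(rmorphM (real_complex R)) nsq_real.
rewrite nsqM nsqV sq nsqM nsqV d'E -(rmorph_nat (real_complex R)) !nsq_real.
have -> : d = d' * m.+1%:R / m.+2%:R by rewrite rec mulrAC divff ?mul1r// pnatr_eq0.
field.
by rewrite (gt_eqF d'0) -natrD nat1r !pnatr_eq0.
Qed.

Lemma iter_mulw j f x :
  iter j (@mulw R) f x = if (j <= x.2)%N then f (x.1, x.2 - j)%N else 0.
Proof.
elim: j x => [|j IH] [a b] /=; first by rewrite subn0.
by case: b => [|b] //=; rewrite /mulw /= IH /= subSS.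
Qed.

Lemma iter_mulz j f x :
  iter j (@mulz R) f x = if (j <= x.1)%N then f (x.1 - j, x.2)%N else 0.
Proof.
elim: j x => [|j IH] [a b] /=; first by rewrite subn0.
by case: a => [|a] //=; rewrite /mulz /= IH /= subSS.
Qed.

Lemma sum_interval q B N : (\sum_(t < N) ((q <= t) && (t < B)) = minn N B - q)%N.
Proof. by elim: N => [|N IH]; rewrite ?big_ord0 ?big_ord_recr /= ?IH; lia. Qed.

(** Since j > 0, the shifts push the exceptional entry of either vector outside the support of the
    other. Where both are nonzero both are 1, and the inner product counts common monomials. *)
Lemma inner_top n j : (0 < j)%N ->
  inner (iter j (@mulw R) (top n)) (iter j (@mulz R) (swp (top n))) =
  if (k %| n + j)%N then ((n %/ k).+2 - (n %% k + j) %/ k)%:R else 0.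
Proof.
move=> j0; pose N := (n + k + j).+1.
pose cond a b := [&& (a + b == n + k + j)%N, (k %| a)%N, (k %| b)%N, (j <= a)%N & (j <= b)%N].
have PE x : iter j (@mulw R) (top n) x * Num.conj (iter j (@mulz R) (swp (top n)) x) =
    (cond x.1 x.2)%:R.
  case: x => a b; rewrite iter_mulw iter_mulz /swp /top /= /cond /=.
  case: (leqP j b) => jb; last by rewrite mul0r !andbF.
  case: (leqP j a) => ja; last by rewrite conjC0 mulr0 !andbF.
  have -> : (a + (b - j) == n + k)%N = (a + b == n + k + j)%N by lia.
  have -> : (b + (a - j) == n + k)%N = (a + b == n + k + j)%N by lia.
  have -> : (a == 0%N) = false by lia.
  have -> : (b == 0%N) = false by lia.
  case: (_ == _) => /=; last by rewrite mul0r.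
  case: (k %| a)%N => /=; last by rewrite mul0r.
  by case: (k %| b)%N; rewrite ?conjC0 ?conjC1 ?mulr0 ?mulr1.
rewrite (@inner_fin _ _ _ N) => [|x]; last first.
  rewrite PE /cond; case: eqP => //= xE /negP[].
  by apply/andP; split; rewrite /N; lia.
rewrite (eq_sqs (t' := fun x => (cond x.1 x.2)%:R)); last by move=> x _ _; exact: PE.
case: ifPn => [kn|nk]; last first.
  rewrite (eq_sqs (t' := fun=> 0)) ?sqs0// => x _ _; rewrite /cond.
  case: eqP => //= xE; case ka : (k %| x.1)%N => //=; case kb : (k %| x.2)%N => //=.
  exfalso; move/negP: nk; apply.
  by rewrite -(dvdn_addl (n + j) (dvdnn k)) addnAC -xE dvdn_add.
set m := (n %/ k)%N; set s := (n %% k)%N; set q := ((s + j) %/ k)%N.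
have sk : (s < k)%N by exact: ltn_pmod.
have nE : n = (k * m + s)%N by rewrite mulnC -divn_eq.
(* As 0 <= s < k, this makes q the ceiling of j / k. For z-exponent k t, the condition j <= k t then
   reads q <= t; for the w-exponent k (m + q + 1 - t), the condition that it be at least j reads t <
   m + 2. *)
have qE : (s + j = k * q)%N.
  rewrite mulnC divnK//; move: kn; rewrite nE -addnA dvdn_addr// dvdn_mulr//.
have NE : (n + k + j = k * (m + q).+1)%N by rewrite nE mulnS mulnDr -qE; lia.
clearbody q; clearbody s m.
pose T := (m + q).+2.
have rowE (a : 'I_N) : \sum_(b < N) (cond a b)%:R =
    \sum_(t < T) (val a == k * t :> nat)%N%:R * ((q <= t) && (t < m.+2))%N%:R :> R[i].
  have aN := ltn_ord a.
  transitivity ((cond a (n + k + j - a)%N)%:R : R[i]).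
    transitivity (\sum_(b < N) (n + k + j - a == b :> nat)%N%:R * (cond a b)%:R : R[i]).
      apply: eq_bigr => b _; case: eqP => [_|ab]; first by rewrite mul1r.
      rewrite mul0r /cond.
      by case: eqP => // abE; case: ab; rewrite -abE addKn.
    by rewrite (sum_pick _ _ (fun b => (cond a b)%:R)) ifT// /N ltnS leq_subr.
  have aNE : (a + (n + k + j - a) = n + k + j)%N by rewrite subnKC// -ltnS.
  rewrite /cond aNE eqxx /=; case ka : (k %| a)%N => /=; last first.
    rewrite big1// => t _; case: eqP => [aE|_]; last by rewrite mul0r.
    by rewrite aE dvdn_mulr in ka.
  have [t aE] := dvdnP ka; rewrite mulnC in aE.
  transitivity (\sum_(t' < T) (t == t' :> nat)%N%:R * ((q <= t') && (t' < m.+2))%N%:R : R[i]).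
    rewrite (sum_pick _ _ (fun t => ((q <= t) && (t < m.+2))%N%:R)).
    have tT : (t < T)%N by rewrite /T ltnS -(leq_pmul2l k_gt0) -aE -NE -ltnS.
    rewrite tT NE aE -mulnBr dvdn_mulr//=; congr (_%:R); congr nat_of_bool.
    have -> : (j <= k * t)%N = (q <= t)%N.
      apply/idP/idP => h; last first.
        by rewrite -(leq_add2l s) qE (leq_trans (leq_mul (leqnn k) h))// leq_addl.
      rewrite -ltnS -(ltn_pmul2l k_gt0) -qE mulnS; move: sk h; lia.
    have -> : (j <= k * ((m + q).+1 - t))%N = (t < m.+2)%N.
      apply/idP/idP => h.
        rewrite ltnS leqNgt; apply/negP => mt.
        have : (k * ((m + q).+1 - t) <= k * (q - 1))%N by rewrite leq_pmul2l//; lia.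
        have : (k * q = k * (q - 1) + k)%N.
          by case: (q) qE => [|q' _]; [rewrite muln0; lia|rewrite subn1 mulnS addnC].
        lia.
      have : (k * q <= k * ((m + q).+1 - t))%N by rewrite leq_pmul2l//; lia.
      lia.
    by [].
  apply: eq_bigr => t' _; congr (_%:R * _); congr nat_of_bool.
  by rewrite aE eqn_pmul2l.
rewrite /sqs; under eq_bigr do rewrite rowE.
rewrite exchange_big /=.
transitivity (\sum_(t < T) ((q <= t) && (t < m.+2))%N%:R : R[i]).
  apply: eq_bigr => t _.
  transitivity (\sum_(a < N) (k * t == a :> nat)%N%:R * ((q <= t) && (t < m.+2))%N%:R : R[i]).
    by apply: eq_bigr => a _; rewrite eq_sym.
  rewrite (sum_pick _ _ (fun=> ((q <= t) && (t < m.+2))%N%:R)) ifT//.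
  by rewrite /N NE ltnS leq_pmul2l// -ltnS; exact: ltn_ord.
rewrite -natr_sum sum_interval; congr (_%:R).
have q0 : (0 < q)%N by case: (q) qE => //; rewrite muln0; lia.
by rewrite /T; lia.
Qed.

(** The subtraction is truncated: the term is 0 as soon as q >= m + 2. *)
Definition sigma_term (q m : nat) : R := ((m.+2 - q)%:R / (m.+1%:R * m.+2%:R)) ^+ 2.

Lemma Sigma_ge2 j : (2 <= j)%N -> exists2 q : nat, (k < j)%N = (1 < q)%N /\ (0 < q)%N &
  Sigma p j = (\esum_(m in [set: nat]) (sigma_term q m)%:E)%E.
Proof.
move=> j2; have j0 : (0 < j)%N by lia.
(* s is -j mod k, written without subtraction; the contributing indices are n = k m + s. *)
pose s := ((k.-1 * j) %% k)%N; pose q := ((s + j) %/ k)%N.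
have sk : (s < k)%N by exact: ltn_pmod.
have ksE n : (k %| n + j)%N = (n %% k == s)%N.
  rewrite /s -[RHS]/(n == k.-1 * j %[mod k]) -(eqn_modDr j) -[in RHS](mulSnr k.-1) prednK//.
  by rewrite modnMr /dvdn.
have qE : (s + j = k * q)%N by rewrite mulnC divnK// ksE modn_small.
have termE n : ComplexField.Normc.normc
    (inner (iter j (@mulw R) (phi p n)) (iter j (@mulz R) (psi p n))) ^+ 2 =
    if (n %% k == s)%N then sigma_term q (n %/ k) else 0.
  have [c cE [-> ->]] := phi_psi n.
  have topH : H2 (top n).
    by rewrite -sum_gsol; apply: H2_sum => l _; apply: H2Z; exact: H2_gvec.
  have itwH f : H2 f -> H2 (iter j (@mulw R) f).
    by move=> fH; elim: (j) => //= i IH; have [] := H2_mulw IH.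
  have itzH f : H2 f -> H2 (iter j (@mulz R) f).
    by move=> fH; elim: (j) => //= i IH; have [] := H2_mulz IH.
  have -> : iter j (@mulw R) (c *: top n) = c *: iter j (@mulw R) (top n).
    apply/funext => x; rewrite -[RHS]/(c * _) !iter_mulw; case: ifP => // _.
    by rewrite mulr0.
  have -> : iter j (@mulz R) (c *: - swp (top n)) = (- c) *: iter j (@mulz R) (swp (top n)).
    apply/funext => x; rewrite -[RHS]/(- c * _) !iter_mulz; case: ifP => // _.
      by rewrite mulNr -mulrN.
    by rewrite mulr0.
  have H1 := itwH _ topH; have H3 := itzH _ (H2_swp topH).
  rewrite innerZl//; last exact: H2Z.
  rewrite innerZr// inner_top// normc_sq !nsqM.
  rewrite nsqJ nsqN cE ksE; case: eqP => [nE|_]; last by rewrite nsq0 !mulr0.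
  rewrite nE -/q -(rmorph_nat (real_complex R)) nsq_real /sigma_term.
  by rewrite exprMn [RHS]mulrC expr2 mulrA.
exists q.
  split; last by case: (q) qE => //; rewrite muln0; lia.
  apply/idP/idP => h.
    by rewrite -(ltn_pmul2l k_gt0) -qE muln1; lia.
  have : (k * 2 <= k * q)%N by rewrite leq_pmul2l.
  by rewrite -qE; lia.
have -> : Sigma p j = (\sum_(0 <= n <oo) (ComplexField.Normc.normc
    (inner (iter j (@mulw R) (phi p n)) (iter j (@mulz R) (psi p n))) ^+ 2)%:E)%E.
  by case: (j) j2 => [|[|]].
rewrite nneseries_esumT => [|n]; last by rewrite lee_fin sqr_ge0.
transitivity (\esum_(n in [set (k * m + s)%N | m in [set: nat]])
    (sigma_term q (n %/ k))%:E)%E.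
  rewrite [RHS]esum_mkcond; apply: eq_esum => n _; rewrite termE.
  case: eqP => [nE|nE].
    by rewrite ifT// inE; exists (n %/ k)%N => //; rewrite mulnC -nE -divn_eq.
  rewrite ifF//; apply/negP; rewrite inE => -[m _ mE]; apply: nE.
  by rewrite -mE mulnC modnMDl modn_small.
rewrite esum_image; last first.
  by move=> x y _ _ /eqP; rewrite eqn_add2r eqn_pmul2l// => /eqP.
by apply: eq_esum => m _; rewrite mulnC divnMDl// divn_small// addn0.
Qed.

Lemma sigma_term1 m : sigma_term 1 m = m.+2%:R ^- 2.
Proof.
by rewrite /sigma_term subSS subn0 invfM mulrA divff ?pnatr_eq0// mul1r exprVn.
Qed.

Lemma Sigma_1 : Sigma p 1 = (\esum_(m in [set: nat]) (sigma_term 1 m)%:E)%E.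
Proof.
by rewrite -[LHS]/(hs2 _ _) hs2_cross_comm//; apply: eq_esum => m _; rewrite sigma_term1.
Qed.

End HigherInvariants.

(** * Strict comparison of the series for q = 1 and q > 1 *)

Section Comparison.
Variable R : realType.

Lemma sigma_term_ge0 q m : 0 <= sigma_term R q m.
Proof. exact: sqr_ge0. Qed.

(** The partial sums are at most 1 - 1/(N + 1), because 1/(N + 2)^2 <= 1/(N + 1) - 1/(N + 2). Only
    finiteness matters: it lets a common tail be cancelled. *)
Lemma esum_sigma_term1_fin : (\esum_(m in [set: nat]) (sigma_term R 1 m)%:E <= 1%:E)%E.
Proof.
rewrite -nneseries_esumT => [|m]; last by rewrite lee_fin sigma_term_ge0.
apply: lime_le; first by apply: is_cvg_nneseries => m _ _; rewrite lee_fin sigma_term_ge0.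
apply: nearW => N; rewrite sumEFin lee_fin big_mkord.
apply: (@le_trans _ _ (1 - N.+1%:R^-1)); last by rewrite gerBl invr_ge0.
elim: N => [|N IH]; first by rewrite big_ord0 invr1 subrr.
rewrite big_ord_recr /= sigma_term1; apply: le_trans (lerD IH (lexx _)) _.
rewrite -subr_ge0.
have -> : 1 - N.+2%:R^-1 - (1 - N.+1%:R^-1 + N.+2%:R ^- 2) =
    (N.+1%:R * N.+2%:R ^+ 2)^-1 :> R.
  by field; rewrite -?natrD ?nat1r !pnatr_eq0.
by rewrite invr_ge0 mulr_ge0// exprn_ge0.
Qed.

(** All terms for q are at most those for 1, and the term m = 0 drops from 1/4 to 0; with finite
    sums this excludes equality. *)
Lemma esum_sigma_term_neq q : (1 < q)%N ->
  (\esum_(m in [set: nat]) (sigma_term R q m)%:E)%E <>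
  (\esum_(m in [set: nat]) (sigma_term R 1 m)%:E)%E.
Proof.
move=> q1 e.
have ge0 q' m : (0 <= (sigma_term R q' m)%:E)%E by rewrite lee_fin sigma_term_ge0.
have le m : sigma_term R q m <= sigma_term R 1 m.
  rewrite lerXn2r ?nnegrE ?divr_ge0// ?mulr_ge0//.
  by rewrite ler_wpM2r ?invr_ge0 ?mulr_ge0// ler_nat; lia.
move: e esum_sigma_term1_fin.
rewrite (esumID [set 0%N] _ (fun m => (sigma_term R q m)%:E))//.
rewrite (esumID [set 0%N] _ (fun m => (sigma_term R 1 m)%:E))//.
rewrite !setTI !esum_set1//.
have -> : sigma_term R q 0 = 0.
  by rewrite /sigma_term (_ : _ - q = 0)%N ?mul0r ?expr0n//; lia.
rewrite add0e sigma_term1.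
have : (\esum_(m in ~` [set 0%N]) (sigma_term R q m)%:E <=
        \esum_(m in ~` [set 0%N]) (sigma_term R 1 m)%:E)%E.
  by apply: le_esum => m _; rewrite lee_fin.
set x := esum _ _; set y := esum _ _ => xy xE; rewrite {}xE in xy.
have y0 : (0 <= y)%E by apply: esum_ge0.
case: y xy y0 => [y| |]//; rewrite -EFinD lee_fin => le_y _ _.
have : 0 < 2%:R ^- 2 :> R by rewrite invr_gt0 exprn_gt0.
by lra.
Qed.

End Comparison.

Theorem corollary4p1 (R : realType) :
  [/\ forall k : nat, (2 <= k)%N ->
        let J := [set j : nat | (1 <= j)%N /\
                    Sigma (Mpoly R k) j = Sigma (Mpoly R k) 1] in
        J k /\ (forall j : nat, J j -> (j <= k)%N),
      forall k l : nat, (2 <= k)%N -> (2 <= l)%N -> k <> l ->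
        Sigma (Mpoly R k) <> Sigma (Mpoly R l)
    & forall k l : nat, (2 <= k)%N -> (2 <= l)%N ->
        forall lam : R[i], lam <> 0 -> forall d : nat,
          has_dim (eigenspace_H2 (core (submodule (Mpoly R k))) lam) d <->
          has_dim (eigenspace_H2 (core (submodule (Mpoly R l))) lam) d].
Proof.
have maxJ k : (2 <= k)%N -> Sigma (Mpoly R k) k = Sigma (Mpoly R k) 1 /\
    forall j, (1 <= j)%N -> Sigma (Mpoly R k) j = Sigma (Mpoly R k) 1 -> (j <= k)%N.
  move=> k2; have k0 : (0 < k)%N by lia.
  rewrite (Sigma_1 R k0); split=> [|j j1].
    have [q [kq q0] ->] := Sigma_ge2 R k0 k2.
    (* At j = k the equivalence reads (k < k) = (1 < q), so q is positive and not above 1. *)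
    by rewrite (_ : q = 1%N)//; move: kq q0; lia.
  have [j2|] := leqP 2 j; last by lia.
  have [q [kq q0] ->] := Sigma_ge2 R k0 j2 => e.
  by rewrite leqNgt kq; apply/negP => q1; exact: esum_sigma_term_neq q1 e.
split.
- move=> k k2; have [kE kmax] := maxJ k k2.
  by split=> [|j [j1 jE]]; [split=> //; lia|exact: kmax].
(* If the sequences agree, k satisfies the condition whose maximum is l, and conversely, so k <= l
   and l <= k. *)
- move=> k l k2 l2 kl e; apply: kl; apply/eqP; rewrite eqn_leq.
  have [kE kmax] := maxJ k k2; have [lE lmax] := maxJ l l2.
  apply/andP; split; [apply: lmax|apply: kmax]; try by lia.
    by rewrite -e.
  by rewrite e.
- move=> k l k2 l2 lam lam0 d.
  have k0 : (0 < k)%N by lia.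
  have l0 : (0 < l)%N by lia.
  exact: (iff_trans (has_dim_core d k0 lam0) (iff_sym (has_dim_core d l0 lam0))).
Qed.
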